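(* Let $\mathcal{E}$ be an idempotent-complete exact category and let $\mathbf{Ac}(\mathcal{E})$, the homotopy category of acyclic cochain complexes in $\mathcal{E}$, be given the $t$-structure for which $\mathbf{Ac}(\mathcal{E})^{\le0}$ (resp. $\mathbf{Ac}(\mathcal{E})^{\ge0}$) consists, up to isomorphism, of the acyclic complexes with $E^i=0$ for all $i>0$ (resp. for all $i<-2$). Then $$\big[\mathbf{Ac}(\mathcal{E})\big]^-=\mathbf{Ac}^-(\mathcal{E}),\qquad \big[\mathbf{Ac}(\mathcal{E})\big]^+=\mathbf{Ac}^+(\mathcal{E}),\qquad \big[\mathbf{Ac}(\mathcal{E})\big]^b=\mathbf{Ac}^b(\mathcal{E}).$$ Consequently the $t$-structure on $\mathbf{Ac}(\mathcal{E})$ restricts to $t$-structures on $\mathbf{Ac}^-(\mathcal{E})$, $\mathbf{Ac}^+(\mathcal{E})$ and $\mathbf{Ac}^b(\mathcal{E})$ (the last being a bounded $t$-structure), and all four categories have the same heart.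
   Context: A cochain complex $(E^*,\partial^* )$ in $\mathcal{E}$ is acyclic if there are admissible short exact sequences $0\to K^i\xrightarrow{\alpha^i}E^i\xrightarrow{\beta^i}K^{i+1}\to0$ with $\partial^i=\alpha^{i+1}\circ\beta^i$ for all $i$. $\mathbf{Ac}(\mathcal{E})$ is the full subcategory of acyclic complexes in the homotopy category $\mathbf{K}(\mathcal{E})$ of all cochain complexes; $\mathbf{Ac}^-(\mathcal{E})$, $\mathbf{Ac}^+(\mathcal{E})$, $\mathbf{Ac}^b(\mathcal{E})$ are the full subcategories of acyclic complexes that are bounded above, bounded below, and bounded, respectively (regarded inside $\mathbf{Ac}(\mathcal{E})$ up to isomorphism). For a triangulated category $\mathcal{T}$ with a $t$-structure, $$\mathcal{T}^-=\bigcup_{n\ge1}\mathcal{T}^{\le n},\qquad \mathcal{T}^+=\bigcup_{n\ge1}\mathcal{T}^{\ge -n},\qquad \mathcal{T}^b=\mathcal{T}^-\cap\mathcal{T}^+,$$ the heart is $\mathcal{T}^{\le0}\cap\mathcal{T}^{\ge0}$, and the $t$-structure is bounded if $\mathcal{T}=\mathcal{T}^b$. *)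

(* Defs.v *)
From HB Require Import structures.
From mathcomp Require Import all_boot all_order all_algebra.
From mathcomp Require Import boolp classical_sets.

Set Implicit Arguments.
Unset Strict Implicit.
Unset Printing Implicit Defensive.

Import GRing.Theory.
Local Open Scope classical_set_scope.
Local Open Scope quotient_scope.
Local Open Scope ring_scope.

Reserved Notation "g \comp f" (at level 40, left associativity).

Record additive_category := AdditiveCategory {
  Ob :> Type;
  Hom : Ob -> Ob -> zmodType;
  idm : forall A, Hom A A;
  comp : forall A B C, Hom B C -> Hom A B -> Hom A C;
  compA : forall A B C D (h : Hom C D) (g : Hom B C) (f : Hom A B),
    comp h (comp g f) = comp (comp h g) f;
  comp1m : forall A B (f : Hom A B), comp (idm B) f = f;
  compm1 : forall A B (f : Hom A B), comp f (idm A) = f;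
  compDl : forall A B C (g g' : Hom B C) (f : Hom A B),
    comp (g + g') f = comp g f + comp g' f;
  compDr : forall A B C (g : Hom B C) (f f' : Hom A B),
    comp g (f + f') = comp g f + comp g f';
  zob : Ob;
  zobP : idm zob = 0;
  dsum : Ob -> Ob -> Ob;
  inl_ : forall A B, Hom A (dsum A B);
  inr_ : forall A B, Hom B (dsum A B);
  prl_ : forall A B, Hom (dsum A B) A;
  prr_ : forall A B, Hom (dsum A B) B;
  prl_inl : forall A B, comp (prl_ A B) (inl_ A B) = idm A;
  prr_inr : forall A B, comp (prr_ A B) (inr_ A B) = idm B;
  prl_inr : forall A B, comp (prl_ A B) (inr_ A B) = 0;
  prr_inl : forall A B, comp (prr_ A B) (inl_ A B) = 0;
  dsumP : forall A B,
    comp (inl_ A B) (prl_ A B) + comp (inr_ A B) (prr_ A B) = idm (dsum A B)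
}.

Arguments Hom {a} : rename.
Arguments idm {a} A : rename.
Arguments comp {a A B C} : rename.
Arguments zob {a} : rename.
Arguments dsum {a} : rename.
Arguments inl_ {a A B} : rename.
Arguments inr_ {a A B} : rename.
Arguments prl_ {a A B} : rename.
Arguments prr_ {a A B} : rename.
Notation "g \comp f" := (comp g f).

Section Additive.
Variable C : additive_category.

Lemma comp0m (X Y Z : C) (f : Hom X Y) : (0 : Hom Y Z) \comp f = 0.
Proof. by apply: (addrI (0 \comp f)); rewrite -compDl !addr0. Qed.

Lemma compm0 (X Y Z : C) (g : Hom Y Z) : g \comp (0 : Hom X Y) = 0.
Proof. by apply: (addrI (g \comp 0)); rewrite -compDr !addr0. Qed.

Lemma compNm (X Y Z : C) (g : Hom Y Z) (f : Hom X Y) :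
  (- g) \comp f = - (g \comp f).
Proof. by apply: (addrI (g \comp f)); rewrite -compDl !subrr comp0m. Qed.

Lemma compmN (X Y Z : C) (g : Hom Y Z) (f : Hom X Y) :
  g \comp (- f) = - (g \comp f).
Proof. by apply: (addrI (g \comp f)); rewrite -compDr !subrr compm0. Qed.

Definition is_zero (X : C) : Prop := idm X = 0.

Definition is_iso (X Y : C) (f : Hom X Y) : Prop :=
  exists g : Hom Y X, g \comp f = idm X /\ f \comp g = idm Y.

Definition isomorphic (X Y : C) : Prop := exists f : Hom X Y, is_iso f.

Definition idempotent_complete : Prop :=
  forall (X : C) (e : Hom X X), e \comp e = e ->
  exists (Y : C) (r : Hom X Y) (s : Hom Y X),
    s \comp r = e /\ r \comp s = idm Y.

Definition is_kernel (X Y Z : C) (i : Hom X Y) (p : Hom Y Z) : Prop :=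
  p \comp i = 0 /\
  forall (W : C) (w : Hom W Y), p \comp w = 0 ->
  exists! u : Hom W X, i \comp u = w.

Definition is_cokernel (X Y Z : C) (i : Hom X Y) (p : Hom Y Z) : Prop :=
  p \comp i = 0 /\
  forall (W : C) (w : Hom Y W), w \comp i = 0 ->
  exists! u : Hom Z W, u \comp p = w.

(* f' \comp i = i' \comp f is a pushout square *)
Definition is_pushout (X Y X' Y' : C)
    (i : Hom X Y) (f : Hom X X') (f' : Hom Y Y') (i' : Hom X' Y') : Prop :=
  f' \comp i = i' \comp f /\
  forall (W : C) (a : Hom Y W) (b : Hom X' W), a \comp i = b \comp f ->
  exists! u : Hom Y' W, u \comp f' = a /\ u \comp i' = b.

(* p \comp f' = f \comp p' is a pullback square *)
Definition is_pullback (Y Z Y' Z' : C)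
    (p : Hom Y Z) (f : Hom Z' Z) (f' : Hom Y' Y) (p' : Hom Y' Z') : Prop :=
  p \comp f' = f \comp p' /\
  forall (W : C) (a : Hom W Y) (b : Hom W Z'), p \comp a = f \comp b ->
  exists! u : Hom W Y', f' \comp u = a /\ p' \comp u = b.

End Additive.

Section AdmissibleMorphisms.
Variable C : additive_category.
(* [ses i p] : the sequence 0 -> X -i-> Y -p-> Z -> 0 is admissible exact *)
Variable ses : forall X Y Z : C, Hom X Y -> Hom Y Z -> Prop.

Definition admissible_mono (X Y : C) (i : Hom X Y) : Prop :=
  exists (Z : C) (p : Hom Y Z), ses i p.

Definition admissible_epi (Y Z : C) (p : Hom Y Z) : Prop :=
  exists (X : C) (i : Hom X Y), ses i p.

End AdmissibleMorphisms.

(* Quillen's axioms, in Buehler's self-dual form. *)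
Record exact_category := ExactCategory {
  ecat :> additive_category;
  ses : forall X Y Z : ecat, Hom X Y -> Hom Y Z -> Prop;
  ses_kernel : forall (X Y Z : ecat) (i : Hom X Y) (p : Hom Y Z),
    ses i p -> is_kernel i p;
  ses_cokernel : forall (X Y Z : ecat) (i : Hom X Y) (p : Hom Y Z),
    ses i p -> is_cokernel i p;
  ses_iso : forall (X Y Z X' Y' Z' : ecat) (i : Hom X Y) (p : Hom Y Z)
      (i' : Hom X' Y') (p' : Hom Y' Z')
      (a : Hom X X') (b : Hom Y Y') (c : Hom Z Z'),
    is_iso a -> is_iso b -> is_iso c ->
    b \comp i = i' \comp a -> c \comp p = p' \comp b -> ses i p -> ses i' p';
  admissible_mono_id : forall X : ecat, admissible_mono ses (idm X);
  admissible_epi_id : forall X : ecat, admissible_epi ses (idm X);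
  admissible_mono_comp : forall (X Y Z : ecat) (i : Hom X Y) (j : Hom Y Z),
    admissible_mono ses i -> admissible_mono ses j ->
    admissible_mono ses (j \comp i);
  admissible_epi_comp : forall (X Y Z : ecat) (p : Hom X Y) (q : Hom Y Z),
    admissible_epi ses p -> admissible_epi ses q ->
    admissible_epi ses (q \comp p);
  admissible_mono_pushout : forall (X Y X' : ecat) (i : Hom X Y) (f : Hom X X'),
    admissible_mono ses i ->
    exists (Y' : ecat) (f' : Hom Y Y') (i' : Hom X' Y'),
      is_pushout i f f' i' /\ admissible_mono ses i';
  admissible_epi_pullback : forall (Y Z Z' : ecat) (p : Hom Y Z) (f : Hom Z' Z),
    admissible_epi ses p ->
    exists (Y' : ecat) (f' : Hom Y' Y) (p' : Hom Y' Z'),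
      is_pullback p f f' p' /\ admissible_epi ses p'
}.

Arguments ses {e X Y Z} : rename.

Record cochain_complex (C : additive_category) := CochainComplex {
  cob :> int -> C;
  cdiff : forall i : int, Hom (cob i) (cob (i + 1));
  cdiff2 : forall i : int, cdiff (i + 1) \comp cdiff i = 0
}.

Section Homotopy.
Variable C : additive_category.
Implicit Types X Y Z : cochain_complex C.

Record chain_map X Y := ChainMap {
  cmap :> forall i : int, Hom (X i) (Y i);
  cmapP : forall i : int, cdiff Y i \comp cmap i = cmap (i + 1) \comp cdiff X i
}.

HB.instance Definition _ X Y := gen_eqMixin (chain_map X Y).
HB.instance Definition _ X Y := gen_choiceMixin (chain_map X Y).

Lemma chain_mapE X Y (f g : chain_map X Y) : (forall i, f i = g i) -> f = g.
Proof.
case: f g => [f fP] [g gP] /= fg.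
have {}fg : f = g by exact: functional_extensionality_dep.
by subst g; congr ChainMap; exact: Prop_irrelevance.
Qed.

Section ChainMapZmodule.
Variables X Y : cochain_complex C.

Fact cmap0P i : cdiff Y i \comp (0 : Hom (X i) (Y i)) = 0 \comp cdiff X i.
Proof. by rewrite comp0m compm0. Qed.
Definition cmap0 : chain_map X Y := @ChainMap X Y (fun=> 0) cmap0P.

Fact cmapNP (f : chain_map X Y) i :
  cdiff Y i \comp (- f i) = (- f (i + 1)) \comp cdiff X i.
Proof. by rewrite compNm compmN cmapP. Qed.
Definition cmapN (f : chain_map X Y) : chain_map X Y :=
  @ChainMap X Y (fun i => - f i) (cmapNP f).

Fact cmapDP (f g : chain_map X Y) i :
  cdiff Y i \comp (f i + g i) = (f (i + 1) + g (i + 1)) \comp cdiff X i.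
Proof. by rewrite compDl compDr !cmapP. Qed.
Definition cmapD (f g : chain_map X Y) : chain_map X Y :=
  @ChainMap X Y (fun i => f i + g i) (cmapDP f g).

Fact cmapDA : associative cmapD.
Proof. by move=> f g h; apply: chain_mapE => i; rewrite /= addrA. Qed.
Fact cmapDC : commutative cmapD.
Proof. by move=> f g; apply: chain_mapE => i; rewrite /= addrC. Qed.
Fact cmap0D : left_id cmap0 cmapD.
Proof. by move=> f; apply: chain_mapE => i; rewrite /= add0r. Qed.
Fact cmapND : left_inverse cmap0 cmapN cmapD.
Proof. by move=> f; apply: chain_mapE => i; rewrite /= addNr. Qed.

HB.instance Definition _ :=
  GRing.isZmodule.Build (chain_map X Y) cmapDA cmapDC cmap0D cmapND.

(* Degrees are written [i + 1] so that no transport is needed; as [i] ranges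
   over all of [int] this covers every degree. *)
Definition null_homotopic (f : chain_map X Y) : Prop :=
  exists s : forall i : int, Hom (X (i + 1)) (Y i),
  forall i : int,
    f (i + 1) = cdiff Y i \comp s i + s (i + 1) \comp cdiff X (i + 1).

Definition null_homotopicb : {pred chain_map X Y} :=
  fun f => `[< null_homotopic f >].

Fact null_homotopic_closed : zmod_closed null_homotopicb.
Proof.
split=> [|f g]; first by apply/asboolP; exists (fun=> 0) => i;
  rewrite comp0m compm0 addr0.
move=> /asboolP[s sP] /asboolP[t tP]; apply/asboolP.
exists (fun i => s i - t i) => i /=.
by rewrite sP tP compDl compDr compNm compmN opprD addrACA.
Qed.

HB.instance Definition _ :=
  GRing.isZmodClosed.Build (chain_map X Y) null_homotopicb
    null_homotopic_closed.

Definition homotopy_class : zmodType := Quotient.quot null_homotopicb.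

Definition hclass (f : chain_map X Y) : homotopy_class :=
  \pi_(Quotient.quot null_homotopicb) f.

Lemma hclassP (a : homotopy_class) : exists f, a = hclass f.
Proof. by exists (repr a); rewrite /hclass reprK. Qed.

Lemma hclass_eq (f g : chain_map X Y) :
  null_homotopic (f - g) -> hclass f = hclass g.
Proof.
by move=> fg; apply/eqmodP; rewrite /= Quotient.equivE; apply/asboolP.
Qed.

Lemma hclass_eqP (f g : chain_map X Y) :
  hclass f = hclass g -> null_homotopic (f - g).
Proof.
by move=> /eqmodP; rewrite /= Quotient.equivE => /asboolP.
Qed.

Lemma hclassD (f g : chain_map X Y) : hclass (f + g) = hclass f + hclass g.
Proof. exact: raddfD. Qed.

Lemma hclass0 : hclass 0 = 0.
Proof. exact: raddf0. Qed.

Definition hrepr (a : homotopy_class) : chain_map X Y := repr a.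

Lemma hreprK a : hclass (hrepr a) = a.
Proof. exact: reprK. Qed.

End ChainMapZmodule.

Fact cmap_idP X i :
  cdiff X i \comp idm (X i) = idm (X (i + 1)) \comp cdiff X i.
Proof. by rewrite comp1m compm1. Qed.
Definition cmap_id X : chain_map X X :=
  @ChainMap X X (fun i => idm (X i)) (@cmap_idP X).

Fact cmap_compP X Y Z (g : chain_map Y Z) (f : chain_map X Y) i :
  cdiff Z i \comp (g i \comp f i) =
  (g (i + 1) \comp f (i + 1)) \comp cdiff X i.
Proof. by rewrite compA cmapP -!compA cmapP. Qed.
Definition cmap_comp X Y Z (g : chain_map Y Z) (f : chain_map X Y) :
    chain_map X Z :=
  @ChainMap X Z (fun i => g i \comp f i) (cmap_compP g f).

Lemma hclass_comp X Y Z (g g' : chain_map Y Z) (f f' : chain_map X Y) :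
  hclass g = hclass g' -> hclass f = hclass f' ->
  hclass (cmap_comp g f) = hclass (cmap_comp g' f').
Proof.
move=> /hclass_eqP[t tP] /hclass_eqP[s sP].
apply: hclass_eq; exists (fun i => t i \comp f (i + 1) + g' i \comp s i) => i.
have -> : cmap_comp g f - cmap_comp g' f' =
    cmap_comp (g - g') f + cmap_comp g' (f - f').
  apply: chain_mapE => j /=.
  by rewrite compDl compDr compNm compmN addrA subrK.
rewrite [LHS]/= (tP i : g (i + 1) - g' (i + 1) = _).
rewrite (sP i : f (i + 1) - f' (i + 1) = _) !compDl !compDr /=.
rewrite !compA -[g' (i + 1) \comp cdiff Y i]cmapP addrACA.
by rewrite -[t (i + 1) \comp cdiff _ _ \comp _]compA (cmapP f) compA.
Qed.

Definition hcomp X Y Z (b : homotopy_class Y Z) (a : homotopy_class X Y) :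
  homotopy_class X Z := hclass (cmap_comp (hrepr b) (hrepr a)).

Lemma hcompE X Y Z (g : chain_map Y Z) (f : chain_map X Y) :
  hcomp (hclass g) (hclass f) = hclass (cmap_comp g f).
Proof. by apply: hclass_comp; rewrite hreprK. Qed.

Fact czero2 (i : int) : (0 : Hom (zob : C) zob) \comp (0 : Hom (zob : C) zob) = 0.
Proof. exact: comp0m. Qed.
Definition czero : cochain_complex C :=
  @CochainComplex C (fun=> zob) (fun=> 0) czero2.

Definition csum_diff X Y (i : int) :
    Hom (dsum (X i) (Y i)) (dsum (X (i + 1)) (Y (i + 1))) :=
  inl_ \comp cdiff X i \comp prl_ + inr_ \comp cdiff Y i \comp prr_.

Fact csum_diff2 X Y i : csum_diff X Y (i + 1) \comp csum_diff X Y i = 0.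
Proof.
rewrite /csum_diff !(compDl, compDr) -!compA !(compA prl_) !(compA prr_).
rewrite prl_inl prl_inr prr_inl prr_inr !(comp0m, comp1m, compm0).
by rewrite !(compA (cdiff _ _)) !cdiff2 !(comp0m, compm0) !addr0.
Qed.
Definition csum X Y : cochain_complex C := CochainComplex (csum_diff2 X Y).

Fact csum_inlP X Y i : cdiff (csum X Y) i \comp (inl_ : Hom (X i) _) =
  (inl_ : Hom _ (csum X Y (i + 1))) \comp cdiff X i.
Proof.
by rewrite /= /csum_diff compDl -!compA prl_inl prr_inl !compm0 compm1 addr0.
Qed.
Definition csum_inl X Y : chain_map X (csum X Y) :=
  @ChainMap X (csum X Y) (fun i => inl_) (@csum_inlP X Y).

Fact csum_inrP X Y i : cdiff (csum X Y) i \comp (inr_ : Hom (Y i) _) =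
  (inr_ : Hom _ (csum X Y (i + 1))) \comp cdiff Y i.
Proof.
by rewrite /= /csum_diff compDl -!compA prl_inr prr_inr !compm0 compm1 add0r.
Qed.
Definition csum_inr X Y : chain_map Y (csum X Y) :=
  @ChainMap Y (csum X Y) (fun i => inr_) (@csum_inrP X Y).

Fact csum_prlP X Y i : cdiff X i \comp (prl_ : Hom (csum X Y i) _) =
  prl_ \comp cdiff (csum X Y) i.
Proof.
by rewrite /= /csum_diff compDr !compA prl_inl prl_inr !comp0m comp1m addr0.
Qed.
Definition csum_prl X Y : chain_map (csum X Y) X :=
  @ChainMap (csum X Y) X (fun i => prl_) (@csum_prlP X Y).

Fact csum_prrP X Y i : cdiff Y i \comp (prr_ : Hom (csum X Y i) _) =
  prr_ \comp cdiff (csum X Y) i.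
Proof.
by rewrite /= /csum_diff compDr !compA prr_inl prr_inr !comp0m comp1m add0r.
Qed.
Definition csum_prr X Y : chain_map (csum X Y) Y :=
  @ChainMap (csum X Y) Y (fun i => prr_) (@csum_prrP X Y).

Definition homotopy_category : additive_category.
Proof.
refine (@AdditiveCategory (cochain_complex C) homotopy_class
  (fun X => hclass (cmap_id X)) hcomp _ _ _ _ _ czero _ csum
  (fun X Y => hclass (csum_inl X Y)) (fun X Y => hclass (csum_inr X Y))
  (fun X Y => hclass (csum_prl X Y)) (fun X Y => hclass (csum_prr X Y))
  _ _ _ _ _).
- move=> X Y Z T c b a.
  have [h ->] := hclassP c; have [g ->] := hclassP b; have [f ->] := hclassP a.
  by rewrite !hcompE; congr hclass; apply: chain_mapE => i /=; rewrite compA.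
- move=> X Y a; have [f ->] := hclassP a; rewrite hcompE.
  by congr hclass; apply: chain_mapE => i /=; rewrite comp1m.
- move=> X Y a; have [f ->] := hclassP a; rewrite hcompE.
  by congr hclass; apply: chain_mapE => i /=; rewrite compm1.
- move=> X Y Z b b' a.
  have [g ->] := hclassP b; have [g' ->] := hclassP b'.
  have [f ->] := hclassP a; rewrite -hclassD !hcompE -hclassD.
  by congr hclass; apply: chain_mapE => i /=; rewrite compDl.
- move=> X Y Z b a a'.
  have [g ->] := hclassP b; have [f ->] := hclassP a.
  have [f' ->] := hclassP a'; rewrite -hclassD !hcompE -hclassD.
  by congr hclass; apply: chain_mapE => i /=; rewrite compDr.
- rewrite -hclass0; congr hclass; apply: chain_mapE => i /=; exact: zobP.
- move=> X Y; rewrite hcompE; congr hclass; apply: chain_mapE => i /=.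
  exact: prl_inl.
- move=> X Y; rewrite hcompE; congr hclass; apply: chain_mapE => i /=.
  exact: prr_inr.
- move=> X Y; rewrite hcompE -hclass0; congr hclass; apply: chain_mapE => i /=.
  exact: prl_inr.
- move=> X Y; rewrite hcompE -hclass0; congr hclass; apply: chain_mapE => i /=.
  exact: prr_inl.
- move=> X Y; rewrite !hcompE -hclassD; congr hclass; apply: chain_mapE => i /=.
  exact: dsumP.
Defined.

Fact cshift2 X i : (- cdiff X (i + 1 + 1)) \comp (- cdiff X (i + 1)) = 0.
Proof. by rewrite compNm compmN opprK cdiff2. Qed.
Definition cshift X : cochain_complex C :=
  @CochainComplex C (fun i => X (i + 1)) (fun i => - cdiff X (i + 1))
    (cshift2 X).

Fact cmap_shiftP X Y (f : chain_map X Y) i :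
  cdiff (cshift Y) i \comp f (i + 1) = f (i + 1 + 1) \comp cdiff (cshift X) i.
Proof. by rewrite /= compNm compmN cmapP. Qed.
Definition cmap_shift X Y (f : chain_map X Y) :
    chain_map (cshift X) (cshift Y) :=
  @ChainMap (cshift X) (cshift Y) (fun i => f (i + 1)) (cmap_shiftP f).

Lemma hclass_shift X Y (f g : chain_map X Y) :
  hclass f = hclass g -> hclass (cmap_shift f) = hclass (cmap_shift g).
Proof.
move=> /hclass_eqP[s sP]; apply: hclass_eq.
exists (fun i => - s (i + 1)) => i.
by have := sP (i + 1); rewrite /= !compNm !compmN !opprK.
Qed.

Definition hshift X Y (a : homotopy_class X Y) :
    homotopy_class (cshift X) (cshift Y) :=
  hclass (cmap_shift (hrepr a)).

Lemma hshiftE X Y (f : chain_map X Y) :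
  hshift (hclass f) = hclass (cmap_shift f).
Proof. by apply: hclass_shift; rewrite hreprK. Qed.

(* d (x, y) = (- d x, f x + d y) on X^(i+1) + Y^i *)
Definition cone_diff X Y (f : chain_map X Y) (i : int) :
    Hom (dsum (X (i + 1)) (Y i)) (dsum (X (i + 1 + 1)) (Y (i + 1))) :=
  inl_ \comp (- cdiff X (i + 1)) \comp prl_
  + inr_ \comp (f (i + 1) \comp prl_ + cdiff Y i \comp prr_).

Fact cone_diff2 X Y (f : chain_map X Y) i :
  cone_diff f (i + 1) \comp cone_diff f i = 0.
Proof.
rewrite /cone_diff !(compDl, compDr) -!compA !(compA prl_) !(compA prr_).
rewrite prl_inl prl_inr prr_inl prr_inr !(comp0m, comp1m, compm0).
rewrite !(compNm, compmN) !(compA (cdiff _ _)) !cdiff2 !(comp0m, compm0).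
by rewrite cmapP !(oppr0, add0r, addr0) -!compA addNr.
Qed.
Definition cone X Y (f : chain_map X Y) : cochain_complex C :=
  CochainComplex (cone_diff2 f).

Fact cone_inP X Y (f : chain_map X Y) i :
  cdiff (cone f) i \comp (inr_ : Hom (Y i) _) =
  (inr_ : Hom _ (cone f (i + 1))) \comp cdiff Y i.
Proof.
rewrite /= /cone_diff !(compDl, compDr) -!compA prl_inr prr_inr.
by rewrite !compm0 compm1 !add0r.
Qed.
Definition cone_in X Y (f : chain_map X Y) : chain_map Y (cone f) :=
  @ChainMap Y (cone f) (fun i => inr_) (cone_inP f).

Fact cone_outP X Y (f : chain_map X Y) i :
  cdiff (cshift X) i \comp (prl_ : Hom (cone f i) _) =
  prl_ \comp cdiff (cone f) i.
Proof.
rewrite /= /cone_diff !(compDl, compDr) !compA prl_inl prl_inr.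
by rewrite !comp0m comp1m !addr0.
Qed.
Definition cone_out X Y (f : chain_map X Y) : chain_map (cone f) (cshift X) :=
  @ChainMap (cone f) (cshift X) (fun i => prl_) (cone_outP f).

End Homotopy.

(* The data of a triangulated category.  The axioms TR1-TR4 are not fields: no
   definition below refers to them, and the only instance used is K(C), for
   which they are classical. *)
Record triangulated_data := TriangulatedData {
  tcat :> additive_category;
  shift : tcat -> tcat;
  shiftm : forall X Y : tcat, Hom X Y -> Hom (shift X) (shift Y);
  shiftm_id : forall X : tcat, shiftm (idm X) = idm (shift X);
  shiftm_comp : forall (X Y Z : tcat) (g : Hom Y Z) (f : Hom X Y),
    shiftm (g \comp f) = shiftm g \comp shiftm f;
  shiftmD : forall (X Y : tcat) (f g : Hom X Y),
    shiftm (f + g) = shiftm f + shiftm g;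
  distinguished : forall X Y Z : tcat,
    Hom X Y -> Hom Y Z -> Hom Z (shift X) -> Prop
}.

Arguments shift {t} : rename.
Arguments shiftm {t X Y} : rename.
Arguments distinguished {t X Y Z} : rename.

Section TStructures.
Variable T : triangulated_data.
Implicit Types (X Y Z : T) (D L G : set T).

(* Full replete subcategories are identified with their sets of objects. *)
Record triangulated_subcategory D : Prop := {
  tsub_zero : D zob;
  tsub_iso : forall X Y, D X -> isomorphic X Y -> D Y;
  tsub_shift : forall X, D (shift X) <-> D X;
  tsub_cone : forall X Y Z (f : Hom X Y) (g : Hom Y Z) (h : Hom Z (shift X)),
    distinguished f g h -> D X -> D Y -> D Z
}.

(* [L] and [G] are D^{<=0} and D^{>=0}.  With D^{<=n} = D^{<=0}[-n] and
   D^{>=n} = D^{>=0}[-n], membership of X in D^{<=1} (resp. D^{>=1}) reads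
   [L (shift X)] (resp. [G (shift X)]). *)
Record tstructure D L G : Prop := {
  tst_triangulated : triangulated_subcategory D;
  tst_leS : L `<=` D;
  tst_geS : G `<=` D;
  tst_le_iso : forall X Y, L X -> isomorphic X Y -> L Y;
  tst_ge_iso : forall X Y, G X -> isomorphic X Y -> G Y;
  tst_le : forall X, L X -> L (shift X);
  tst_ge : forall X, D X -> G (shift X) -> G X;
  tst_orth : forall X Y (f : Hom X Y), L X -> D Y -> G (shift Y) -> f = 0;
  tst_trunc : forall X, D X ->
    exists (A B : T) (f : Hom A X) (g : Hom X B) (h : Hom B (shift A)),
      [/\ distinguished f g h, L A, D B & G (shift B)]
}.

Definition tst_le_n D L (n : nat) : set T :=
  [set X | D X /\ L (iter n shift X)].

(* D^{>=-n} = D^{>=0}[n] *)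
Definition tst_ge_Nn D G (n : nat) : set T :=
  [set X | D X /\ exists2 Y, G Y & isomorphic X (iter n shift Y)].

Definition tst_minus D L : set T :=
  \bigcup_(n in [set n | 1 <= n]%N) tst_le_n D L n.

Definition tst_plus D G : set T :=
  \bigcup_(n in [set n | 1 <= n]%N) tst_ge_Nn D G n.

Definition tst_b D L G : set T := tst_minus D L `&` tst_plus D G.

Definition tst_bounded D L G : Prop := D = tst_b D L G.

Definition heart L G : set T := L `&` G.

End TStructures.

Section HomotopyTriangulated.
Variable C : additive_category.
Let K := homotopy_category C.

(* (a, b, c) is an isomorphism from X -> Y -> Z -> X[1] to
   X' -> Y' -> cone f' -> X'[1]. *)
Definition hdistinguished (X Y Z : K)
    (f : Hom X Y) (g : Hom Y Z) (h : Hom Z (cshift X : K)) : Prop :=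
  exists (X' Y' : cochain_complex C) (f' : chain_map X' Y')
    (a : Hom X (X' : K)) (b : Hom Y (Y' : K)) (c : Hom Z (cone f' : K)),
  [/\ is_iso a, is_iso b, is_iso c &
   [/\ b \comp f = (hclass f' : Hom (X' : K) Y') \comp a,
      c \comp g = (hclass (cone_in f') : Hom (Y' : K) (cone f')) \comp b &
      (hshift a : Hom (cshift X : K) (cshift X')) \comp h =
        (hclass (cone_out f') : Hom (cone f' : K) (cshift X')) \comp c]].

Definition KC : triangulated_data.
Proof.
refine (@TriangulatedData K (@cshift C) (@hshift C) _ _ _ hdistinguished).
- by move=> X; rewrite hshiftE; congr hclass; apply: chain_mapE.
- move=> X Y Z b a; have [g ->] := hclassP b; have [f ->] := hclassP a.
  by rewrite /= hcompE !hshiftE hcompE; congr hclass; apply: chain_mapE.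
- move=> X Y b a; have [g ->] := hclassP b; have [f ->] := hclassP a.
  rewrite -hclassD !hshiftE -hclassD; congr hclass.
  exact: chain_mapE.
Defined.

End HomotopyTriangulated.

Section Acyclic.
Variable E : exact_category.
Implicit Types X : cochain_complex E.

Definition acyclic X : Prop :=
  exists (K : int -> E) (alpha : forall i, Hom (K i) (X i))
    (beta : forall i, Hom (X i) (K (i + 1))),
  forall i, ses (alpha i) (beta i) /\ cdiff X i = alpha (i + 1) \comp beta i.

Definition zero_above (n : int) X : Prop := forall i, n < i -> is_zero (X i).
Definition zero_below (n : int) X : Prop := forall i, i < n -> is_zero (X i).

Definition bounded_above X : Prop := exists n, zero_above n X.
Definition bounded_below X : Prop := exists n, zero_below n X.

Definition Ac : set (KC E) := [set X | acyclic X].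

(* The objects of Ac(E) isomorphic in K(E) to an acyclic complex satisfying P *)
Definition Ac_such (P : cochain_complex E -> Prop) : set (KC E) :=
  [set X | Ac X /\ exists Y : KC E, [/\ Ac Y, P Y & isomorphic X Y]].

Definition Ac_minus : set (KC E) := Ac_such bounded_above.
Definition Ac_plus : set (KC E) := Ac_such bounded_below.
Definition Ac_b : set (KC E) :=
  Ac_such (fun X => bounded_above X /\ bounded_below X).

Definition Ac_le0 : set (KC E) := Ac_such (zero_above 0).
Definition Ac_ge0 : set (KC E) := Ac_such (zero_below (- 2)).

End Acyclic.

Arguments Ac E : clear implicits.
Arguments Ac_minus E : clear implicits.
Arguments Ac_plus E : clear implicits.
Arguments Ac_b E : clear implicits.
Arguments Ac_le0 E : clear implicits.
Arguments Ac_ge0 E : clear implicits.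

(* Main.v *)
(* Two characterizations carry the proof.
   A complex over an idempotent-complete exact category is acyclic if and only
   if its differentials have kernels and every generalized cycle is a boundary
   after pulling back along an admissible epimorphism; idempotent completeness
   enters because it makes g an admissible epimorphism as soon as some g v is
   one.  This criterion passes to homotopy equivalent complexes, to cones and to
   the truncation ... -> X^-2 -> X^-1 -> ker d^0 -> 0 by diagram chases.
   An acyclic complex is homotopy equivalent to one vanishing in the degrees > n
   (or in the degrees < n) if and only if its identity is null-homotopic in
   these degrees.  The latter condition is stable under isomorphism, shifts and
   cones, which reduces the bounded versions of the t-structure to bookkeeping
   on n. *)
Require Import Defs.
From mathcomp Require Import all_boot all_order all_algebra.
From mathcomp Require Import boolp classical_sets.
From mathcomp Require Import zify.
Import Defs.

Local Open Scope classical_set_scope.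

Set Implicit Arguments.
Unset Strict Implicit.
Unset Printing Implicit Defensive.

Import Order.TTheory GRing.Theory Num.Theory.
Local Open Scope ring_scope.

Local Notation adm_epi := (admissible_epi (@ses _)).
Local Notation adm_mono := (admissible_mono (@ses _)).

Lemma dependent_choice (I : Type) (T : I -> Type) (P : forall i, T i -> Prop) :
  (forall i, exists x, P i x) -> exists f, forall i, P i (f i).
Proof. by move=> ex; exists (fun i => sval (cid (ex i))) => i; case: cid. Qed.

Lemma forall_succ (P : int -> Prop) :
  (forall i : int, P (i + 1)) -> forall i : int, P i.
Proof. by move=> PS i; rewrite -(subrK 1 i). Qed.

(* Families indexed by the degrees [i + 1]: since [i - 1 + 1] is not convertible
   to [i], this is where the transport is paid for. *)
Lemma extend_succ (T : int -> Type) (f : forall i : int, T (i + 1)) :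
  exists g : forall i : int, T i, forall i : int, g (i + 1) = f i.
Proof.
exists (fun j => eq_rect _ T (f (j - 1)) _ (subrK 1 j)) => i.
have: i + 1 - 1 = i by rewrite addrK.
move: (i + 1 - 1) (subrK 1 (i + 1)) => k e ki; rewrite ki in e *.
by rewrite (eq_irrelevance e erefl).
Qed.

(** * Additive categories *)

Section AdditiveCategory.
Variable C : additive_category.
Implicit Types A B W X Y Z : C.

Definition monic X Y (f : Hom X Y) : Prop :=
  forall W (u v : Hom W X), f \comp u = f \comp v -> u = v.

Definition epic X Y (f : Hom X Y) : Prop :=
  forall W (u v : Hom Y W), u \comp f = v \comp f -> u = v.

Lemma monic0 X Y (f : Hom X Y) :
  (forall W (u : Hom W X), f \comp u = 0 -> u = 0) -> monic f.
Proof.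
move=> f0 W u v fuv; apply/subr0_eq/f0.
by rewrite compDr compmN fuv subrr.
Qed.

Lemma kernel_monic X Y Z (i : Hom X Y) (p : Hom Y Z) :
  is_kernel i p -> monic i.
Proof.
move=> [pi ker] W u v iuv.
have [|w [_ wP]] := ker W (i \comp v); first by rewrite compA pi comp0m.
by rewrite -(wP u) // (wP v).
Qed.

Lemma cokernel_epic X Y Z (i : Hom X Y) (p : Hom Y Z) :
  is_cokernel i p -> epic p.
Proof.
move=> [pi coker] W u v upv.
have [|w [_ wP]] := coker W (v \comp p); first by rewrite -compA pi compm0.
by rewrite -(wP u) // (wP v).
Qed.

Lemma kernel_lift X Y Z (i : Hom X Y) (p : Hom Y Z) W (w : Hom W Y) :
  is_kernel i p -> p \comp w = 0 -> exists u, i \comp u = w.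
Proof. by move=> [_ ker] /ker[u [uP _]]; exists u. Qed.

Lemma cokernel_desc X Y Z (i : Hom X Y) (p : Hom Y Z) W (w : Hom Y W) :
  is_cokernel i p -> w \comp i = 0 -> exists u, u \comp p = w.
Proof. by move=> [_ coker] /coker[u [uP _]]; exists u. Qed.

Lemma kernelI X Y Z (i : Hom X Y) (p : Hom Y Z) :
  p \comp i = 0 -> monic i ->
  (forall W (w : Hom W Y), p \comp w = 0 -> exists u, i \comp u = w) ->
  is_kernel i p.
Proof.
move=> pi mi lift; split=> // W w /lift[u uP].
by exists u; split=> // v; rewrite -uP => /mi.
Qed.

Lemma cokernelI X Y Z (i : Hom X Y) (p : Hom Y Z) :
  p \comp i = 0 -> epic p ->
  (forall W (w : Hom Y W), w \comp i = 0 -> exists u, u \comp p = w) ->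
  is_cokernel i p.
Proof.
move=> pi ep desc; split=> // W w /desc[u uP].
by exists u; split=> // v; rewrite -uP => /ep.
Qed.

(** Since [cdiff X i] is [alpha (i + 1) \comp beta i] with [alpha (i + 1)] monic, this passes
    between kernels of the differential and kernels of [beta i]. *)
Lemma kernel_comp_monic X Y Z W (i : Hom X Y) (p : Hom Y Z) (m : Hom Z W) :
  monic m -> is_kernel i (m \comp p) <-> is_kernel i p.
Proof.
move=> mm; have E T (w : Hom T Y) : (m \comp p) \comp w = 0 <-> p \comp w = 0.
  split=> [|pw]; last by rewrite -compA pw compm0.
  by rewrite -compA -(compm0 _ m) => /mm.
by split=> -[pi ker]; (split; first exact/E) => T w /E; apply: ker.
Qed.

Lemma kernel_unique X X' Y Z (i : Hom X Y) (i' : Hom X' Y) (p : Hom Y Z) :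
  is_kernel i p -> is_kernel i' p ->
  exists2 u : Hom X X', is_iso u & i' \comp u = i.
Proof.
move=> ki ki'.
have [u iu] := kernel_lift ki' (proj1 ki).
have [v iv] := kernel_lift ki (proj1 ki').
exists u => //; exists v; split.
  by apply: (kernel_monic ki); rewrite compA iv iu compm1.
by apply: (kernel_monic ki'); rewrite compA iu iv compm1.
Qed.

Lemma cokernel_unique X Y Z Z' (i : Hom X Y) (p : Hom Y Z) (p' : Hom Y Z') :
  is_cokernel i p -> is_cokernel i p' ->
  exists2 u : Hom Z Z', is_iso u & u \comp p = p'.
Proof.
move=> ci ci'.
have [u iu] := cokernel_desc ci (proj1 ci').
have [v iv] := cokernel_desc ci' (proj1 ci).
exists u => //; exists v; split.
  by apply: (cokernel_epic ci); rewrite -compA iu iv comp1m.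
by apply: (cokernel_epic ci'); rewrite -compA iv iu comp1m.
Qed.

Lemma iso_id X : is_iso (idm X).
Proof. by exists (idm X); rewrite comp1m. Qed.

Lemma iso_comp X Y Z (g : Hom Y Z) (f : Hom X Y) :
  is_iso g -> is_iso f -> is_iso (g \comp f).
Proof.
move=> [g' [gg' g'g]] [f' [ff' f'f]]; exists (f' \comp g'); split.
  by rewrite -compA (compA g') gg' comp1m.
by rewrite -compA (compA f) f'f comp1m.
Qed.

Lemma iso_monic X Y (f : Hom X Y) : is_iso f -> monic f.
Proof.
by move=> [g [gf _]] W u v /(congr1 (comp g)); rewrite !compA gf !comp1m.
Qed.

Lemma isomorphic_refl X : isomorphic X X.
Proof. by exists (idm X); exact: iso_id. Qed.

Lemma isomorphic_sym X Y : isomorphic X Y -> isomorphic Y X.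
Proof. by move=> [f [g [gf fg]]]; exists g, f. Qed.

Lemma isomorphic_trans X Y Z :
  isomorphic X Y -> isomorphic Y Z -> isomorphic X Z.
Proof. by move=> [f fi] [g gi]; exists (g \comp f); exact: iso_comp. Qed.

Lemma hom_to_zero X Y (f : Hom X Y) : is_zero Y -> f = 0.
Proof. by move=> Y0; rewrite -(comp1m f) Y0 comp0m. Qed.

Lemma hom_from_zero X Y (f : Hom X Y) : is_zero X -> f = 0.
Proof. by move=> X0; rewrite -(compm1 f) X0 compm0. Qed.

Lemma kernel_zero_morphism X Y : is_kernel (idm X) (0 : Hom X Y).
Proof.
split=> [|W w _]; first by rewrite comp0m.
by exists w; split=> [|v]; rewrite comp1m.
Qed.

Lemma eq_to_dsum W A B (f g : Hom W (dsum A B)) :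
  prl_ \comp f = prl_ \comp g -> prr_ \comp f = prr_ \comp g -> f = g.
Proof.
by move=> l r; rewrite -(comp1m f) -(comp1m g) -dsumP !compDl -!compA l r.
Qed.

Definition pair_mor W A B (f : Hom W A) (g : Hom W B) : Hom W (dsum A B) :=
  inl_ \comp f + inr_ \comp g.

Definition copair_mor W A B (f : Hom A W) (g : Hom B W) : Hom (dsum A B) W :=
  f \comp prl_ + g \comp prr_.

Lemma prl_pair W A B (f : Hom W A) (g : Hom W B) :
  prl_ \comp pair_mor f g = f.
Proof. by rewrite compDr !compA prl_inl prl_inr comp1m comp0m addr0. Qed.

Lemma prr_pair W A B (f : Hom W A) (g : Hom W B) :
  prr_ \comp pair_mor f g = g.
Proof. by rewrite compDr !compA prr_inl prr_inr comp1m comp0m add0r. Qed.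

Lemma copair_pair V W A B (f : Hom A W) (g : Hom B W) (u : Hom V A)
    (v : Hom V B) :
  copair_mor f g \comp pair_mor u v = f \comp u + g \comp v.
Proof. by rewrite compDl -!compA prl_pair prr_pair. Qed.

Lemma pair_comp V W A B (f : Hom W A) (g : Hom W B) (u : Hom V W) :
  pair_mor f g \comp u = pair_mor (f \comp u) (g \comp u).
Proof. by rewrite compDl -!compA. Qed.

(* The naive homotopy [(x, y) |-> (- s x, t y)] only contracts the cone up to
   the unipotent map [(x, y) |-> (x, y - u x)] with [u = f s - t f]; the term [t u]
   compensates for this. *)
Lemma cone_contraction X1 X2 X3 Y0 Y1 Y2 Y3
    (d1 : Hom X1 X2) (d2 : Hom X2 X3) (s1 : Hom X2 X1) (s2 : Hom X3 X2)
    (e0 : Hom Y0 Y1) (e1 : Hom Y1 Y2) (e2 : Hom Y2 Y3)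
    (t0 : Hom Y1 Y0) (t1 : Hom Y2 Y1) (t2 : Hom Y3 Y2)
    (f1 : Hom X1 Y1) (f2 : Hom X2 Y2) (f3 : Hom X3 Y3) :
  e1 \comp f1 = f2 \comp d1 -> e2 \comp f2 = f3 \comp d2 ->
  idm X2 = d1 \comp s1 + s2 \comp d2 ->
  idm Y1 = e0 \comp t0 + t1 \comp e1 -> idm Y2 = e1 \comp t1 + t2 \comp e2 ->
  idm (dsum X2 Y1) =
    pair_mor (- (d1 \comp prl_)) (f1 \comp prl_ + e0 \comp prr_) \comp
    pair_mor (- (s1 \comp prl_))
      (t0 \comp ((f1 \comp s1 - t1 \comp f2) \comp prl_ + prr_)) +
    pair_mor (- (s2 \comp prl_))
      (t1 \comp ((f2 \comp s2 - t2 \comp f3) \comp prl_ + prr_)) \comp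
    pair_mor (- (d2 \comp prl_)) (f2 \comp prl_ + e1 \comp prr_).
Proof.
move=> ef1 ef2 idX idY1 idY2.
set u := f1 \comp s1 - t1 \comp f2; set u' := f2 \comp s2 - t2 \comp f3.
(* The relation comes from inserting the two contraction identities, in [X2] and in [Y2], on either
   side of [f2]. *)
have eu : e1 \comp u = - (u' \comp d2).
  rewrite /u /u' compDr compmN compDl compNm opprB !compA ef1 -!compA -ef2.
  have : f2 \comp (d1 \comp s1 + s2 \comp d2) =
      (e1 \comp t1 + t2 \comp e2) \comp f2.
    by rewrite -idX -idY2 compm1 comp1m.
  rewrite compDr compDl -!compA => E.
  by apply/eqP; rewrite subr_eq addrAC eq_sym subr_eq E addrC.
have fs1 : f1 \comp s1 = u + t1 \comp f2 by rewrite subrK.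
clearbody u u'; apply: eq_to_dsum; rewrite compm1 compDr.
  rewrite !(compA prl_) !prl_pair !compNm -!compA !prl_pair !compmN !opprK !compA.
  by rewrite -compDl -idX comp1m.
rewrite !(compA prr_) !prr_pair compDl -!compA !prl_pair !prr_pair.
rewrite compDl compDr -!compA prl_pair prr_pair !compmN.
rewrite [u' \comp _]compA -[u' \comp d2]opprK -eu compNm opprK.
rewrite !compDr !compA.
have -> : e0 \comp t0 = idm Y1 - t1 \comp e1 by rewrite idY1 addrK.
rewrite fs1 !compDl !comp1m !compNm opprD.
rewrite [RHS](AC ((2*(2*2))*(1*2)) ((1*3)*(2*8)*(4*7)*(6*9)*5)).
by rewrite /= !addNr !add0r.
Qed.


End AdditiveCategory.

(** * Exact categories *)

Section ExactCategory.
Variable E : exact_category.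
Implicit Types W X Y Z P : E.

Lemma adm_epi_iso X Y (f : Hom X Y) : is_iso f -> adm_epi f.
Proof.
move=> fi; have [W [i ii]] := admissible_epi_id X.
exists W, i; apply: (ses_iso (iso_id W) (iso_id X) fi _ _ ii).
  by rewrite comp1m compm1.
by [].
Qed.

Lemma adm_epi_epic X Y (p : Hom X Y) : adm_epi p -> epic p.
Proof. by move=> [W [i /ses_cokernel/cokernel_epic]]. Qed.

(** A cokernel of [idm X] is a zero object, hence isomorphic to [zob]. *)
Lemma adm_epi_zero X : adm_epi (0 : Hom X zob).
Proof.
have [Z [p pP]] := admissible_mono_id X.
have [p0 _] := ses_cokernel pP; rewrite compm1 in p0.
have Z0 : idm Z = 0.
  by apply: (cokernel_epic (ses_cokernel pP)); rewrite p0 !compm0.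
have Zi : is_iso (0 : Hom Z zob).
  by exists 0; rewrite !comp0m Z0 zobP.
exists X, (idm X); apply: (ses_iso (iso_id X) (iso_id X) Zi _ _ pP) => //.
by rewrite p0 !comp0m.
Qed.

Lemma ses_of_kernel X Y Z (i : Hom X Y) (p : Hom Y Z) :
  adm_epi p -> is_kernel i p -> ses i p.
Proof.
move=> [X' [i' ip]] ki.
have [u ui iu] := kernel_unique (ses_kernel ip) ki.
by apply: (ses_iso ui (iso_id Y) (iso_id Z) _ _ ip);
  rewrite comp1m // compm1.
Qed.

Lemma ses_of_cokernel X Y Z (i : Hom X Y) (p : Hom Y Z) :
  adm_mono i -> is_cokernel i p -> ses i p.
Proof.
move=> [Z' [p' ip]] ci.
have [u ui iu] := cokernel_unique (ses_cokernel ip) ci.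
by apply: (ses_iso (iso_id X) (iso_id Y) ui _ _ ip);
  rewrite ?comp1m ?compm1.
Qed.

(** The axiom provides some pullback along which admissibility is preserved; the given one differs
    from it by an isomorphism. *)
Lemma adm_epi_of_pullback Y Z Y' Z' (p : Hom Y Z) (f : Hom Z' Z)
    (f' : Hom Y' Y) (p' : Hom Y' Z') :
  is_pullback p f f' p' -> adm_epi p -> adm_epi p'.
Proof.
move=> [sq pb] /(admissible_epi_pullback f)[Y1 [f1 [p1 [[sq1 pb1] ep1]]]].
have [u [[fu pu] _]] := pb1 _ _ _ sq.
have [v [[fv pv] _]] := pb _ _ _ sq1.
rewrite -pu; apply: admissible_epi_comp => //; apply: adm_epi_iso.
exists v; split.
  have [w [_ wP]] := pb _ _ _ sq.
  rewrite -(wP (idm _)) ?compm1 //; apply/esym/wP.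
  by rewrite !compA fv pv fu pu.
have [w [_ wP]] := pb1 _ _ _ sq1.
rewrite -(wP (idm _)) ?compm1 //; apply/esym/wP.
by rewrite !compA fu pu fv pv.
Qed.

Lemma adm_mono_of_pushout X Y X' Y' (i : Hom X Y) (f : Hom X X')
    (f' : Hom Y Y') (i' : Hom X' Y') :
  is_pushout i f f' i' -> adm_mono i -> adm_mono i'.
Proof.
move=> [sq po] /(admissible_mono_pushout f)[Y1 [f1 [i1 [[sq1 po1] ei1]]]].
have [u [[fu iu] _]] := po1 _ _ _ sq.
have [v [[fv iv] _]] := po _ _ _ sq1.
have [Z [p ip]] := ei1.
have vu : v \comp u = idm _.
  have [w [_ wP]] := po1 _ _ _ sq1.
  rewrite -(wP (idm _)) ?comp1m //; apply/esym/wP.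
  by rewrite -!compA fu iu.
have uv : u \comp v = idm _.
  have [w [_ wP]] := po _ _ _ sq.
  rewrite -(wP (idm _)) ?comp1m //; apply/esym/wP.
  by rewrite -!compA fv iv.
exists Z, (p \comp v); apply: (ses_iso (iso_id X') _ (iso_id Z) _ _ ip).
- by exists v; split; [exact: vu | exact: uv].
- by rewrite compm1.
- by rewrite comp1m -compA vu compm1.
Qed.

(** The projection is the pullback of [X -> 0] along [Y -> 0]. *)
Lemma adm_epi_prr X Y : adm_epi (prr_ : Hom (dsum X Y) Y).
Proof.
apply: (@adm_epi_of_pullback _ _ _ _ (0 : Hom X zob) (0 : Hom Y zob) prl_ _ _
  (adm_epi_zero X)).
split=> [|W a b _]; first by rewrite !comp0m.
exists (pair_mor a b); split=> [|u [au bu]]; first by rewrite prl_pair prr_pair.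
by apply: eq_to_dsum; rewrite ?prl_pair ?prr_pair.
Qed.

(** The map [1 + q] is the pullback of [q] along the projection of [dsum X Z] onto [Z]. *)
Lemma adm_epi_dsum_id X Y Z (q : Hom Y Z) : adm_epi q ->
  adm_epi (pair_mor prl_ (q \comp prr_) : Hom (dsum X Y) (dsum X Z)).
Proof.
move=> eq; apply: (@adm_epi_of_pullback _ _ _ _ q prr_ prr_ _ _ eq).
split=> [|W a b qab]; first by rewrite prr_pair.
exists (pair_mor (prl_ \comp b) a); split=> [|u [au bu]].
  split; first by rewrite prr_pair.
  rewrite pair_comp -compA prl_pair prr_pair.
  by apply: eq_to_dsum; rewrite ?prl_pair ?prr_pair.
apply: eq_to_dsum; rewrite ?prl_pair ?prr_pair //.
by rewrite -bu compA prl_pair.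
Qed.

(* [(g, 0) : X + W -> P] is the composite of two shears, [1 + g v] and a
   projection. *)
Lemma adm_epi_comp_prl W X P (v : Hom W X) (g : Hom X P) :
  adm_epi (g \comp v) ->
  adm_epi (g \comp (prl_ : Hom (dsum X W) X)).
Proof.
move=> eq.
pose sh : Hom (dsum X W) (dsum X W) :=
  pair_mor (prl_ - v \comp prr_) prr_.
pose sh' : Hom (dsum X P) (dsum X P) := pair_mor prl_ (g \comp prl_ + prr_).
have -> : g \comp (prl_ : Hom (dsum X W) X) =
    prr_ \comp (sh' \comp (pair_mor prl_ (g \comp v \comp prr_) \comp sh)).
  rewrite [prr_ \comp (sh' \comp _)]compA prr_pair compDl.
  rewrite -compA [prl_ \comp (_ \comp sh)]compA prl_pair.
  rewrite [prr_ \comp (_ \comp sh)]compA prr_pair -compA prl_pair prr_pair.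
  by rewrite compDr compmN !compA subrK.
have shi : is_iso sh.
  exists (pair_mor (prl_ + v \comp prr_) prr_).
  rewrite !pair_comp !compDl !compNm -!compA !prl_pair !prr_pair subrK addrK.
  by split; exact: dsumP.
have shi' : is_iso sh'.
  exists (pair_mor prl_ (prr_ - g \comp prl_)).
  rewrite !pair_comp !compDl !compNm -!compA !prl_pair !prr_pair.
  rewrite addrAC subrr add0r addrC subrK; split; exact: dsumP.
apply: admissible_epi_comp (adm_epi_prr _ _).
apply: admissible_epi_comp (adm_epi_iso shi').
apply: admissible_epi_comp (adm_epi_iso shi) _.
exact: adm_epi_dsum_id.
Qed.

(* The kernel [m : M -> X + W] of [g prl] contains [W] as a direct summand; a
   complement [K] of [W] in [M] is then a kernel of [g]. *)
Lemma adm_epi_of_comp_prl W X P (g : Hom X P) : idempotent_complete E ->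
  adm_epi (g \comp (prl_ : Hom (dsum X W) X)) ->
  adm_epi g.
Proof.
move=> idE [M [m mg]].
have km := ses_kernel mg; have cm := ses_cokernel mg.
have [u mu] : exists u : Hom W M, m \comp u = inr_.
  by apply: (kernel_lift km); rewrite -compA prl_inr compm0.
(* [e] is the projection that kills the copy [u] of [W] inside [M]; its image is the complement. *)
pose e : Hom M M := idm M - u \comp prr_ \comp m.
have eu : e \comp u = 0.
  by rewrite compDl comp1m compNm -!compA mu prr_inr compm1 subrr.
have ee : e \comp e = e.
  by rewrite {2}/e compDr compm1 compmN !compA eu !comp0m subr0.
have [K [r [s [sr rs]]]] := idE _ _ ee.
have ru : r \comp u = 0.
  by rewrite -(comp1m r) -rs -!compA (compA s) sr eu compm0.
pose k : Hom K X := prl_ \comp m \comp s.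
have kr : k \comp r = prl_ \comp m.
  rewrite /k -compA sr compDr compm1 compmN -!compA [m \comp (u \comp _)]compA.
  by rewrite mu [prl_ \comp (inr_ \comp _)]compA prl_inr comp0m subr0.
(* [k] is the pushout of [m] along [r]: if [a \comp m] factors through [r], then [a] kills [inr_]
   because [r \comp u = 0], so [a] factors through [prl_]. *)
have kadm : adm_mono k.
  apply: (@adm_mono_of_pushout _ _ _ _ m r prl_ k); last by exists P, (g \comp prl_).
  split=> [|Z a b ab]; first by rewrite kr.
  have ai : a \comp inr_ = 0 by rewrite -mu compA ab -compA ru compm0.
  have aE : (a \comp inl_) \comp prl_ = a.
    by rewrite -{2}(compm1 a) -dsumP compDr !compA ai comp0m addr0.
  exists (a \comp inl_); split=> [|c [ca _]].
    by split=> //; rewrite /k !compA aE ab -compA rs compm1.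
  by rewrite -ca -compA prl_inl compm1.
exists K, k; apply: ses_of_cokernel => //; apply: cokernelI.
- by rewrite /k !compA (proj1 km) comp0m.
- move=> Z a b ab; have := cokernel_epic cm (u := a) (v := b).
  by apply; rewrite !compA ab.
move=> Z w wk.
have [|t tP] := @cokernel_desc _ _ _ _ _ _ _ (w \comp prl_) cm.
  by rewrite -compA -kr compA wk comp0m.
exists t; rewrite -[LHS]compm1 -(prl_inl X W) compA -(compA t) tP.
by rewrite -compA prl_inl compm1.
Qed.

Lemma adm_epi_of_comp W X P (v : Hom W X) (g : Hom X P) :
  idempotent_complete E -> adm_epi (g \comp v) ->
  adm_epi g.
Proof. by move=> idE /adm_epi_comp_prl; exact: adm_epi_of_comp_prl. Qed.

End ExactCategory.

(** * Contractibility in a range of degrees *)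

Section Complexes.
Variable C : additive_category.
Implicit Types X Y Z : cochain_complex C.

Definition zero_on (P : int -> Prop) X : Prop :=
  forall i : int, P i -> is_zero (X i).

Definition contractible_on (P : int -> Prop) X : Prop :=
  exists s : forall i : int, Hom (X (i + 1)) (X i),
  forall i : int, P (i + 1) ->
    idm (X (i + 1)) = cdiff X i \comp s i + s (i + 1) \comp cdiff X (i + 1).

Lemma hclass_homotopicP X Y (f g : chain_map X Y) :
  hclass f = hclass g <->
  exists s : forall i : int, Hom (X (i + 1)) (Y i), forall i : int,
    f (i + 1) =
      g (i + 1) + (cdiff Y i \comp s i + s (i + 1) \comp cdiff X (i + 1)).
Proof.
split=> [/hclass_eqP[s sP]|[s sP]]; [|apply: hclass_eq]; exists s => i.
  by rewrite -sP /= [RHS]addrC subrK.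
by rewrite [LHS]/= sP addrAC subrr add0r.
Qed.

Lemma KC_isomorphicP (X Y : KC C) :
  isomorphic X Y <->
  exists (f : chain_map X Y) (g : chain_map Y X)
    (s : forall i : int, Hom (X (i + 1)) (X i))
    (t : forall i : int, Hom (Y (i + 1)) (Y i)),
    (forall i : int, idm (X (i + 1)) = g (i + 1) \comp f (i + 1) +
      (cdiff X i \comp s i + s (i + 1) \comp cdiff X (i + 1))) /\
    (forall i : int, idm (Y (i + 1)) = f (i + 1) \comp g (i + 1) +
      (cdiff Y i \comp t i + t (i + 1) \comp cdiff Y (i + 1))).
Proof.
split=> [[a [b [ba ab]]]|[f [g [s [t [sP tP]]]]]].
  move: ba ab; have [f ->] := hclassP a; have [g ->] := hclassP b.
  rewrite /= !hcompE => /esym/hclass_homotopicP[s sP].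
  move=> /esym/hclass_homotopicP[t tP].
  by exists f, g, s, t.
exists (hclass f), (hclass g); rewrite /= !hcompE.
by split; apply/esym/hclass_homotopicP; [exists s | exists t].
Qed.

(** A partial contraction [c] of [Y] is carried to [g c f + s], where [s] is the homotopy between
    the identity of [X] and [g f]. *)
Lemma contractible_on_iso (P : int -> Prop) (X Y : KC C) :
  isomorphic X Y -> contractible_on P Y -> contractible_on P X.
Proof.
move=> /KC_isomorphicP[f [g [s [t [sP _]]]]] [c cP].
exists (fun i : int => g i \comp c i \comp f (i + 1) + s i) => i /cP ci.
rewrite sP compDr compDl !compA (cmapP g) -!compA -(cmapP f) addrACA.
congr (_ + _); rewrite -compDr; congr (_ \comp _).
by rewrite !compA -compDl -ci comp1m.
Qed.

Lemma contractible_on_sub (P Q : int -> Prop) X :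
  (forall i : int, P i -> Q i) -> contractible_on Q X -> contractible_on P X.
Proof. by move=> PQ [s sP]; exists s => i /PQ; exact: sP. Qed.

Lemma zero_contractible_on (P : int -> Prop) X :
  zero_on P X -> contractible_on P X.
Proof.
by move=> X0; exists (fun=> 0) => i /X0 ->; rewrite compm0 comp0m addr0.
Qed.

Lemma contractible_on_cshift (P Q : int -> Prop) X :
  (forall i : int, P i -> Q (i + 1)) ->
  contractible_on Q X -> contractible_on P (cshift X).
Proof.
move=> PQ [s sP]; exists (fun i : int => - s (i + 1)) => i /PQ /sP /= ->.
by rewrite !compNm !compmN !opprK.
Qed.

Lemma contractible_on_of_cshift (P Q : int -> Prop) X :
  (forall i : int, Q (i + 1) -> P i) ->
  contractible_on P (cshift X) -> contractible_on Q X.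
Proof.
move=> QP [s sP].
have [t tP] := extend_succ (T := fun i => Hom (X (i + 1)) (X i)) s.
exists (fun i : int => - t i); elim/forall_succ=> i /QP /sP /= ->.
by rewrite !tP !compNm !compmN.
Qed.

Lemma cone_diffE X Y (f : chain_map X Y) i :
  cdiff (cone f) i =
  pair_mor (- (cdiff X (i + 1) \comp prl_))
           (f (i + 1) \comp prl_ + cdiff Y i \comp prr_).
Proof. by rewrite /= /cone_diff /pair_mor -compA compNm. Qed.

(** Degree [i] of the cone consists of [X (i + 1)] and [Y i]. The correction term of the homotopy
    also uses the contraction of [Y] in degree [i + 1], whence the third requirement. *)
Lemma contractible_on_cone (P Q R : int -> Prop) X Y (f : chain_map X Y) :
  (forall i : int, P i -> [/\ R (i + 1), Q i & Q (i + 1)]) ->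
  contractible_on R X -> contractible_on Q Y -> contractible_on P (cone f).
Proof.
move=> PQR [s sP] [t tP].
pose h i := pair_mor (- (s (i + 1) \comp prl_))
  (t i \comp ((f (i + 1) \comp s (i + 1) - t (i + 1) \comp f (i + 1 + 1))
     \comp prl_ + prr_)) : Hom (cone f (i + 1)) (cone f i).
exists h => i /PQR[/sP si /tP ti /tP ti1]; rewrite !cone_diffE.
exact: (cone_contraction (cmapP f _) (cmapP f _)).
Qed.


(** The idempotent splits in each degree; as [e] commutes with the differential, [r d s] is a
    differential on the images. *)
Lemma split_idempotent_map X (e : chain_map X X) :
  idempotent_complete C -> (forall i : int, e i \comp e i = e i) ->
  exists Y (r : chain_map X Y) (s : chain_map Y X),
    (forall i : int, s i \comp r i = e i) /\
    (forall i : int, r i \comp s i = idm (Y i)).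
Proof.
move=> idC ee.
have [Y YP] := dependent_choice (fun i : int => idC _ _ (ee i)).
have [r rP] := dependent_choice YP.
have [s sP] := dependent_choice rP.
pose d i := r (i + 1) \comp cdiff X i \comp s i.
have sd i : s (i + 1) \comp d i = cdiff X i \comp s i.
  by rewrite /d !compA (sP _).1 -(cmapP e) -(sP i).1 -!compA (sP i).2 compm1.
have rd i : d i \comp r i = r (i + 1) \comp cdiff X i.
  rewrite /d -compA (sP i).1 -compA (cmapP e) -(sP _).1 !compA (sP _).2.
  by rewrite comp1m.
have dd i : d (i + 1) \comp d i = 0.
  by rewrite {1}/d -compA sd -compA (compA (cdiff X _)) cdiff2 comp0m compm0.
exists (CochainComplex dd), (@ChainMap _ X (CochainComplex dd) r rd).
exists (@ChainMap _ (CochainComplex dd) X s (fun i : int => esym (sd i))).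
by split=> i; have [] := sP i.
Qed.

(** Both composites of [d h + h d] with [d] equal [d h d]. The map is prescribed in the degrees
    [i + 1] and spread to all degrees by [extend_succ]. *)
Lemma exists_homotopy_map X (h : forall i : int, Hom (X (i + 1)) (X i)) :
  exists e : chain_map X X, forall i : int, e (i + 1) =
    idm (X (i + 1)) - (cdiff X i \comp h i + h (i + 1) \comp cdiff X (i + 1)).
Proof.
have [e eP] := extend_succ (T := fun i => Hom (X i) (X i)) (fun i : int =>
  idm (X (i + 1)) - (cdiff X i \comp h i + h (i + 1) \comp cdiff X (i + 1))).
suff ed i : cdiff X i \comp e i = e (i + 1) \comp cdiff X i.
  by exists (ChainMap ed).
elim/forall_succ: i => i; rewrite !eP !compDr !compDl compm1 comp1m.
rewrite !compmN !compNm !compDl !compDr !compA cdiff2 comp0m add0r.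
by rewrite -(compA (h (i + 1 + 1))) cdiff2 compm0 addr0.
Qed.

(* If [s] contracts [X] on [P] and [h] is [s] restricted to the degrees at which
   [P] starts or ends, then [e = 1 - (d h + h d)] is a chain idempotent
   homotopic to the identity and zero on [P]; its image is the truncation. *)
Lemma contractible_on_zero_on (P : int -> Prop) X :
  idempotent_complete C ->
  (forall i : int, P i -> P (i + 1 + 1) -> P (i + 1)) ->
  contractible_on P X ->
  exists Y, [/\ @isomorphic (KC C) X Y, zero_on P Y &
    forall Q, zero_on Q X -> zero_on Q Y].
Proof.
move=> idC Pconv [s sP].
(* A contraction at either end of a differential makes [s] a generalized inverse of it. *)
have sreg i : P i \/ P (i + 1) -> cdiff X i \comp s i \comp cdiff X i = cdiff X i.
  case=> [|/sP sPi]; last first.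
    rewrite -[RHS]comp1m sPi compDl -(compA (s _)) cdiff2 compm0.
    by rewrite addr0.
  elim/forall_succ: i => i /sP sPi.
  by rewrite -[RHS]compm1 sPi compDr !compA cdiff2 comp0m add0r.
have /dependent_choice[h hP] (i : int) : exists h : Hom (X (i + 1)) (X i),
    ((P i \/ P (i + 1)) -> h = s i) /\ (~ (P i \/ P (i + 1)) -> h = 0).
  by have [Pi|nPi] := pselect (P i \/ P (i + 1)); [exists (s i) | exists 0].
(* So [h d] and, by the next claim, [d h] are idempotent in every degree. *)
have hreg i : h i \comp cdiff X i \comp h i \comp cdiff X i = h i \comp cdiff X i.
  have [Pi|nPi] := pselect (P i \/ P (i + 1)).
    by rewrite (hP i).1 // -2!compA (compA (cdiff X i)) sreg.
  by rewrite (hP i).2 // !comp0m.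
have hreg' i : cdiff X i \comp h i \comp cdiff X i \comp h i = cdiff X i \comp h i.
  have [Pi|nPi] := pselect (P i \/ P (i + 1)).
    by rewrite (hP i).1 // sreg.
  by rewrite (hP i).2 // !compm0.
have [e eP] := exists_homotopy_map h.
have e0 i : P i -> e i = 0.
  elim/forall_succ: i => i Pi; rewrite eP.
  rewrite (hP i).1 ?(hP (i + 1)).1; [|by left|by right].
  by rewrite -sP // subrr.
(* Outside [P], convexity leaves at most one neighbouring degree in [P], so one of the terms [d h]
   and [h d] vanishes and [e] is the complement of a single idempotent. *)
have ee i : e i \comp e i = e i.
  have idem (u : Hom (X i) (X i)) : u \comp u = u ->
      (idm _ - u) \comp (idm _ - u) = idm _ - u.
    move=> uu; rewrite compDr compm1 compmN compDl comp1m compNm uu subrr.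
    by rewrite oppr0 addr0.
  have [Pi|nPi] := pselect (P i); first by rewrite e0 // comp0m.
  elim/forall_succ: i idem nPi => i idem nPi; rewrite eP.
  have [Pi|nPi'] := pselect (P i); last first.
    by rewrite (hP i).2 ?compm0 ?add0r; [apply: idem; rewrite compA hreg|case].
  rewrite (hP (i + 1)).2 ?comp0m ?addr0.
    by apply: idem; rewrite compA hreg'.
  by case=> // /(Pconv _ Pi).
have [Y [p [j [jp pj]]]] := split_idempotent_map idC ee.
have zero Q : (forall i : int, Q i -> e i = 0) -> zero_on Q Y.
  move=> eQ i /eQ ei.
  by rewrite /is_zero -pj -[j i]compm1 -(pj i) !compA -(compA (p i)) jp ei
    compm0 !comp0m.
exists Y; split; [|exact: zero|by move=> Q X0; apply: zero => i /X0/hom_to_zero].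
apply/KC_isomorphicP; exists p, j, h, (fun=> 0); split=> i.
  by rewrite jp eP subrK.
by rewrite pj compm0 comp0m !addr0.
Qed.

(** Shifting back leads to the index [i + 1 - 1], which is not convertible to [i]; the maps [cast]
    are identities transported along equalities of indices. *)
Lemma exists_unshift (X : KC C) : exists Y : KC C, isomorphic X (shift Y).
Proof.
pose cast i j (e : i = j) : Hom (X i) (X j) :=
  eq_rect i (fun k => Hom (X i) (X k)) (idm (X i)) j e.
have cast_id i (e : i = i) : cast i i e = idm (X i).
  by rewrite (eq_irrelevance e erefl).
have castK i j (e : i = j) (e' : j = i) : cast j i e' \comp cast i j e = idm _.
  by case: _ / e e' => e'; rewrite !cast_id comp1m.
have cast_comp i j k (e : i = j) (e' : j = k) (e'' : i = k) :
    cast j k e' \comp cast i j e = cast i k e''.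
  by case: _ / e' e'' => e''; case: _ / e e'' => e''; rewrite !cast_id comp1m.
have cast_d (i j : int) (e : i = j) (e' : i + 1 = j + 1) :
    cdiff X j \comp cast i j e = cast _ _ e' \comp cdiff X i.
  by case: _ / e e' => e'; rewrite !cast_id comp1m compm1.
have eS (i : int) : i - 1 + 1 = i + 1 - 1 by rewrite subrK addrK.
pose d (i : int) : Hom (X (i - 1)) (X (i + 1 - 1)) :=
  - (cast _ _ (eS i) \comp cdiff X (i - 1)).
have dd (i : int) : d (i + 1) \comp d i = 0.
  rewrite /d compNm compmN opprK -compA (compA (cdiff X _)).
  rewrite (cast_d _ _ (eS i) (congr1 (+%R^~ 1) (eS i))).
  by rewrite -(compA (cast _ _ _)) cdiff2 !compm0.
pose Y := CochainComplex dd.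
have eK (i : int) : i = i + 1 - 1 by rewrite addrK.
pose f (i : int) : Hom (X i) (cshift Y i) := cast _ _ (eK i).
pose g (i : int) : Hom (cshift Y i) (X i) := cast _ _ (esym (eK i)).
have fP (i : int) : cdiff (cshift Y) i \comp f i = f (i + 1) \comp cdiff X i.
  rewrite /= /d opprK /f -compA (cast_d _ _ (eK i) (congr1 (+%R^~ 1) (eK i))).
  by rewrite compA (cast_comp _ _ _ _ _ (eK (i + 1))).
have gP (i : int) : cdiff X i \comp g i = g (i + 1) \comp cdiff (cshift Y) i.
  rewrite /= /d opprK /g (cast_d _ _ _ (congr1 (+%R^~ 1) (esym (eK i)))).
  by rewrite compA (cast_comp _ _ _ _ _ (congr1 (+%R^~ 1) (esym (eK i)))).
exists Y; apply/KC_isomorphicP.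
exists (@ChainMap _ X (cshift Y) f fP), (@ChainMap _ (cshift Y) X g gP).
exists (fun=> 0), (fun=> 0).
by split=> i; rewrite /= comp0m compm0 !addr0 castK.
Qed.

Lemma isomorphic_shift (X Y : KC C) :
  isomorphic X Y -> isomorphic (shift X) (shift Y).
Proof.
move=> [f [g [gf fg]]]; exists (shiftm f), (shiftm g).
by rewrite -!shiftm_comp gf fg !shiftm_id.
Qed.

Lemma exists_iter_unshift n (X : KC C) :
  exists Y : KC C, isomorphic X (iter n shift Y).
Proof.
elim: n X => [|n IHn] X; first by exists X; exact: isomorphic_refl.
have [Y XY] := exists_unshift X; have [Z YZ] := IHn Y.
by exists Z; apply: isomorphic_trans XY _; exact: isomorphic_shift.
Qed.

(** The truncation triangle is built for a bounded representative of an object; this replaces the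
    representative by the object itself. *)
Lemma distinguished_iso_mid (X Y Y' Z : KC C) (f : Hom X Y') (g : Hom Y' Z)
    (h : Hom Z (shift X)) (b : Hom Y Y') (b' : Hom Y' Y) :
  b \comp b' = idm Y' -> b' \comp b = idm Y ->
  distinguished f g h -> distinguished (b' \comp f) (g \comp b) h.
Proof.
move=> bb' b'b [X1 [Y1 [f1 [a [c [k [ai ci ki [sq1 sq2 sq3]]]]]]]].
exists X1, Y1, f1, a, (c \comp b), k; split=> //.
  by apply: iso_comp => //; exists b'.
split=> //; first by rewrite compA -(compA c) bb' compm1.
by rewrite !compA sq2.
Qed.

Lemma distinguished_cone X Y (f : chain_map X Y) :
  @distinguished (KC C) _ _ _
    (hclass f) (hclass (cone_in f)) (hclass (cone_out f)).
Proof.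
exists X, Y, f, (idm (X : KC C)), (idm (Y : KC C)), (idm (cone f : KC C)).
split; try exact: iso_id.
split; rewrite ?comp1m ?compm1 //.
have -> : hshift (idm (X : KC C)) = idm (shift (X : KC C)).
  exact: (@shiftm_id (KC C)).
by rewrite (@comp1m (KC C)).
Qed.

Lemma exists_subcomplex X (T : int -> C) (j : forall i : int, Hom (T i) (X i)) :
  (forall i : int, monic (j i)) ->
  (forall i : int, exists u, j (i + 1) \comp u = cdiff X i \comp j i) ->
  exists (d : forall i : int, Hom (T i) (T (i + 1)))
    (dd : forall i : int, d (i + 1) \comp d i = 0),
    forall i : int, cdiff X i \comp j i = j (i + 1) \comp d i.
Proof.
move=> mj /dependent_choice[d dP]; exists d.
suff dd i : d (i + 1) \comp d i = 0 by exists dd => i; rewrite dP.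
apply: (mj (i + 1 + 1)).
by rewrite compm0 compA dP -compA dP compA cdiff2 comp0m.
Qed.

End Complexes.

(** * Acyclic complexes *)

Section AcyclicComplexes.
Variable E : exact_category.
Implicit Types X Y Z : cochain_complex E.

Definition has_kernels X : Prop :=
  forall i : int, exists (K : E) (a : Hom K (X i)), is_kernel a (cdiff X i).

(* Exactness at [X^(i+1)] of the complex of represented sheaves for the topology
   of admissible epimorphisms. *)
Definition locally_exact X : Prop :=
  forall (i : int) (W : E) (w : Hom W (X (i + 1))),
    cdiff X (i + 1) \comp w = 0 ->
    exists (W' : E) (q : Hom W' W) (v : Hom W' (X i)),
      adm_epi q /\ w \comp q = cdiff X i \comp v.

Lemma adm_epi_lift (Y Z W : E) (p : Hom Y Z) (f : Hom W Z) : adm_epi p ->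
  exists (W' : E) (q : Hom W' W) (v : Hom W' Y),
    adm_epi q /\ f \comp q = p \comp v.
Proof.
move=> /(admissible_epi_pullback f)[W' [v [q [[sq _] eq]]]].
by exists W', q, v.
Qed.

Lemma acyclic_has_kernels X : acyclic X -> has_kernels X.
Proof.
move=> [K [al [be P]]] i; exists (K i), (al i); rewrite (P i).2.
apply/(kernel_comp_monic _ _ (kernel_monic (ses_kernel (P (i + 1)).1))).
exact: ses_kernel (P i).1.
Qed.

Lemma acyclic_locally_exact X : acyclic X -> locally_exact X.
Proof.
move=> [K [al [be P]]] i W w; rewrite (P (i + 1)).2 -compA.
rewrite -(compm0 _ (al (i + 1 + 1))) => /(kernel_monic (ses_kernel (P _).1)).
move=> /(kernel_lift (ses_kernel (P _).1))[u <-].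
have [|W' [q [v [eq uq]]]] := @adm_epi_lift _ _ _ (be i) u.
  by exists (K i), (al i); exact: (P i).1.
by exists W', q, v; rewrite (P i).2 -!compA uq.
Qed.

Lemma acyclicP X : idempotent_complete E ->
  acyclic X <-> has_kernels X /\ locally_exact X.
Proof.
move=> idE; split=> [aX|[/dependent_choice[K /dependent_choice[al kerP]] lex]].
  by split; [exact: acyclic_has_kernels | exact: acyclic_locally_exact].
have /dependent_choice[be beP] (i : int) :
    exists b : Hom (X i) (K (i + 1)), al (i + 1) \comp b = cdiff X i.
  by apply: kernel_lift (kerP _) (cdiff2 _ _).
exists K, al, be => i; split; last by rewrite beP.
apply: ses_of_kernel; last first.
  apply/(kernel_comp_monic _ _ (kernel_monic (kerP (i + 1)))).
  by rewrite beP; exact: kerP.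
(* Local exactness is applied to the universal cycle [al (i + 1)]. *)
have [W' [q [v [eq aq]]]] := lex i _ (al (i + 1)) (proj1 (kerP _)).
apply: (@adm_epi_of_comp _ _ _ _ v) => //.
suff -> : be i \comp v = q by [].
by apply: (kernel_monic (kerP (i + 1))); rewrite compA beP aq.
Qed.

Lemma acyclic_czero : idempotent_complete E -> acyclic (czero E).
Proof.
move=> /acyclicP ->; split=> [i|i W w _].
  by exists zob, (idm zob); exact: kernel_zero_morphism.
exists W, (idm W), 0; split; first exact: admissible_epi_id.
by rewrite compm0; apply: hom_to_zero; exact: zobP.
Qed.

Lemma acyclic_cshift X : idempotent_complete E ->
  acyclic (cshift X) <-> acyclic X.
Proof.
move=> idE; rewrite !acyclicP //.
have N0 (A B W : E) (d : Hom A B) (w : Hom W A) :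
    (- d) \comp w = 0 <-> d \comp w = 0.
  by rewrite compNm; split=> [/eqP|->]; rewrite ?oppr0 // oppr_eq0 => /eqP.
have kerN (K A B : E) (a : Hom K A) (d : Hom A B) :
    is_kernel a (- d) <-> is_kernel a d.
  by split=> -[da ker]; (split; first exact/N0) => W w /N0; apply: ker.
have idq (A B : E) (f : Hom A B) : f = - f \comp - idm A.
  by rewrite compNm compmN opprK compm1.
split=> -[ker lex].
  split; elim/forall_succ=> i.
    by have [K [a /kerN ka]] := ker i; exists K, a.
  move=> W w /N0/(lex i)[W' [q [v [eq wq]]]]; exists W', q, (- v).
  by rewrite wq /= compNm compmN.
split=> [i|i W w /N0 /(lex (i + 1))[W' [q [v [eq wq]]]]].
  by have [K [a ka]] := ker (i + 1); exists K, a; apply/kerN.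
by exists W', q, (- v); rewrite wq /= compNm compmN opprK.
Qed.

(* With [1 = g f + d s + s d], a cycle [y] of [X] is [g (f y) + d (s y)]; so the
   cycles of [X] are the image of an idempotent on [K + X^i], where [K] is the
   kernel of the differential of [Y]. *)
Lemma acyclic_isomorphic (X Y : KC E) : idempotent_complete E ->
  isomorphic X Y -> acyclic Y -> acyclic X.
Proof.
move=> idE /KC_isomorphicP[f [g [s [_ [sP _]]]]].
move=> aY; have kerY := acyclic_has_kernels aY.
have lexY := acyclic_locally_exact aY; apply/acyclicP => //.
have cyc (i : int) W (w : Hom W (X (i + 1))) : cdiff X (i + 1) \comp w = 0 ->
    w = g (i + 1) \comp (f (i + 1) \comp w) + cdiff X i \comp (s i \comp w).
  by move=> dw; rewrite -[LHS]comp1m sP !compDl -!compA dw !compm0 addr0.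
split; last first.
  move=> i W w dw; have [|W' [q [v [eq fwq]]]] := lexY i W (f (i + 1) \comp w).
    by rewrite compA cmapP -compA dw compm0.
  exists W', q, (g i \comp v + s i \comp w \comp q); split=> //.
  rewrite {1}(cyc i W w dw) compDl compDr -(compA (g _)) fwq.
  by rewrite !compA cmapP.
elim/forall_succ=> i; have [K [a ka]] := kerY (i + 1).
(* Every cycle of [X] in degree [i + 1] factors through [h], and [h] takes values in cycles. *)
pose h := copair_mor (g (i + 1) \comp a) (cdiff X i).
have dh : cdiff X (i + 1) \comp h = 0.
  rewrite /h /copair_mor compDr !compA cmapP -(compA (g _)) (proj1 ka).
  by rewrite cdiff2 compm0 !comp0m addr0.
have [|ph aph] := @kernel_lift _ _ _ _ _ _ _ (f (i + 1) \comp h) ka.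
  by rewrite compA cmapP -compA dh compm0.
pose e := pair_mor ph (s i \comp h).
have he : h \comp e = h.
  by rewrite copair_pair -compA aph -cyc.
(* Thus [e] depends only on the values of [h]; together with [he] this makes [e] idempotent and
   [h \comp j] monic. *)
have phe A (u v : Hom A (dsum K (X i))) : h \comp u = h \comp v ->
    e \comp u = e \comp v.
  move=> huv; rewrite !pair_comp -!compA huv; congr (pair_mor _ _).
  by apply: (kernel_monic ka); rewrite !compA aph -!compA huv.
have [N [r [j [jr rj]]]] : exists (N : E) (r : Hom (dsum K (X i)) N) j,
    j \comp r = e /\ r \comp j = idm N.
  by apply: idE; rewrite -[RHS]compm1; apply: phe; rewrite he compm1.
exists N, (h \comp j); apply: kernelI.
- by rewrite compA dh comp0m.
- move=> W u v; rewrite -!compA => /phe; rewrite -jr -!compA !(compA r) rj.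
  rewrite !comp1m => /(congr1 (comp r)).
  by rewrite !compA rj !comp1m.
move=> W w dw; have [|w' aw'] := @kernel_lift _ _ _ _ _ _ _ (f (i + 1) \comp w) ka.
  by rewrite compA cmapP -compA dw compm0.
exists (r \comp pair_mor w' (s i \comp w)).
by rewrite -compA (compA j) jr compA he copair_pair -compA aw' -cyc.
Qed.

(** A cycle of the cone is a pair [(x, y)] with [d x = 0] and [d y = - f x], so the kernel is the
    pullback of the admissible epimorphism from [Y i] onto cycles along [- f] on the cycles of
    [X]. *)
Lemma acyclic_cone X Y (f : chain_map X Y) : idempotent_complete E ->
  acyclic X -> acyclic Y -> acyclic (cone f).
Proof.
move=> idE aX aY; have lexX := acyclic_locally_exact aX.
have lexY := acyclic_locally_exact aY; have kerX := acyclic_has_kernels aX.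
apply/acyclicP => //; split.
  move=> i; rewrite cone_diffE; have [K [a ka]] := kerX (i + 1).
  have [KY [al [be beP]]] := aY.
  have kal := ses_kernel (beP (i + 1)).1; have mal := kernel_monic kal.
  have kalY : is_kernel (al (i + 1)) (cdiff Y (i + 1)).
    rewrite (beP (i + 1)).2.
    by apply/(kernel_comp_monic _ _ (kernel_monic (ses_kernel (beP _).1))).
  have [|u au] := @kernel_lift _ _ _ _ _ _ _ (- (f (i + 1) \comp a)) kalY.
    by rewrite compmN compA cmapP -compA (proj1 ka) compm0 oppr0.
  have ebe : adm_epi (be i) by exists (KY i), (al i); exact: (beP i).1.
  have [N [v [k [[sq pb] _]]]] := admissible_epi_pullback u ebe.
  exists N, (pair_mor (a \comp k) v); apply: kernelI.
  - rewrite pair_comp compNm compDl -!compA prl_pair prr_pair.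
    rewrite compA (proj1 ka) comp0m oppr0 compA.
    rewrite (beP i).2 -(compA (al _)) sq (compA (al _)) au compNm subrr.
    by rewrite /pair_mor !compm0 addr0.
  - move=> W w w' /[dup] /(congr1 (comp prl_)) + /(congr1 (comp prr_)).
    rewrite !compA !prl_pair !prr_pair -!compA => /(kernel_monic ka) kw vw.
    have [|t [_ tP]] := pb W (v \comp w) (k \comp w).
      by rewrite !compA sq.
    by rewrite -(tP w) // (tP w').
  move=> W w dw.
  have dwl := congr1 (comp prl_) dw; have dwr := congr1 (comp prr_) dw.
  rewrite compA prl_pair compm0 compNm -compA in dwl.
  move/eqP: dwl; rewrite oppr_eq0 => /eqP /(kernel_lift ka)[x xP].
  rewrite compA prr_pair compm0 compDl -!compA -xP in dwr.
  have [|t [[tv tk] _]] := pb W (prr_ \comp w) x.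
    apply: mal; rewrite !compA au -(beP i).2 compNm -!compA.
    by apply/eqP; rewrite -addr_eq0 [eqbLHS]addrC dwr.
  exists t; apply: eq_to_dsum; rewrite compA ?prl_pair ?prr_pair //.
  by rewrite -compA tk.
(* The cover is refined twice: first to write the [X]-component as [d x], then to write the
   [Y]-component plus [f x] as a boundary. The sign of [x] is that of the cone differential. *)
move=> i W w; rewrite !cone_diffE => dw.
have dwl := congr1 (comp prl_) dw; have dwr := congr1 (comp prr_) dw.
rewrite compA prl_pair compm0 compNm -compA in dwl.
rewrite compA prr_pair compm0 compDl -!compA in dwr.
move/eqP: dwl; rewrite oppr_eq0 => /eqP /lexX[W1 [q1 [x [eq1 xP]]]].
have [|W2 [q2 [y [eq2 yP]]]] :=
    lexY i W1 (prr_ \comp w \comp q1 + f (i + 1) \comp x).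
  rewrite compDr (compA (cdiff Y _) (f _)) cmapP -(compA (f _)) -xP.
  by rewrite -[RHS](comp0m _ q1) -dwr compDl [LHS]addrC -!compA.
exists W2, (q1 \comp q2), (pair_mor (- (x \comp q2)) y).
split; first exact: admissible_epi_comp.
apply: eq_to_dsum; rewrite !compA ?prl_pair ?prr_pair.
  by rewrite compNm -[in RHS]compA prl_pair compmN opprK xP -compA.
rewrite compDl -2![in RHS]compA prl_pair prr_pair -yP compDl compmN !compA.
by rewrite addrCA addNr addr0.
Qed.


(** The vanishing clause lets [T] inherit bounds from [X]; the contractibility clause places the
    cone of [j], the third vertex of the truncation triangle, in degrees at least -1. *)
Lemma exists_truncation X : idempotent_complete E -> acyclic X ->
  exists T (j : chain_map T X),
    [/\ acyclic T, zero_above 0 T, forall P, zero_on P X -> zero_on P T &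
        contractible_on (fun i => i < -1) (cone j)].
Proof.
move=> idE aX; have kerX := acyclic_has_kernels aX.
have lexX := acyclic_locally_exact aX.
have /dependent_choice[T /dependent_choice[j jP]] (i : int) :
    exists (T : E) (j : Hom T (X i)), [/\ i < 0 -> is_iso j,
      i = 0 -> is_kernel j (cdiff X i) & 0 < i -> is_zero T].
  case: (ltgtP i 0) => i0.
  - by exists (X i), (idm (X i)); split=> //; [move=> _; exact: iso_id|lia].
  - by exists zob, 0; split=> //; [lia|move=> _; exact: zobP].
  by have [K [a ka]] := kerX i; exists K, a; split; [lia|move=> _|lia].
have mj i : monic (j i).
  have [jlt jeq jgt] := jP i; case: (ltgtP i 0) => [/jlt|/jgt|/jeq].
  - exact: iso_monic.
  - by move=> T0 W u v _; rewrite (hom_to_zero u T0) (hom_to_zero v T0).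
  exact: kernel_monic.
have dj0 i : 0 <= i -> cdiff X i \comp j i = 0.
  have [_ jeq jgt] := jP i; case: (ltgtP i 0) => [//|/jgt T0 _|/jeq[-> //]].
  exact: hom_from_zero.
have [i|d [dd dP]] := exists_subcomplex mj.
  have [jlt jeq jgt] := jP (i + 1).
  case: (ltgtP (i + 1) 0) => [/jlt[p [pj jp]]|i0|/jeq kj].
  - by exists (p \comp (cdiff X i \comp j i)); rewrite compA jp comp1m.
  - by exists 0; rewrite compm0 dj0 //; lia.
  by apply: (kernel_lift kj); rewrite compA cdiff2 comp0m.
pose TT := CochainComplex dd; pose J := @ChainMap _ TT X j dP.
have zT P : zero_on P X -> zero_on P TT.
  move=> X0 i /X0 Xi; apply: (mj i); rewrite compm0.
  exact: hom_to_zero.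
(* [p] inverts [j] in negative degrees and is 0 elsewhere. *)
have /dependent_choice[p pP] (i : int) : exists p : Hom (X i) (T i),
    i < 0 -> j i \comp p = idm _ /\ p \comp j i = idm _.
  case: (ltP i 0) => i0; last by exists 0; lia.
  by have [/(_ i0)[p [pj jp]] _ _] := jP i; exists p.
exists TT, J; split=> //; last first.
(* The homotopy is [(t, x) |-> (p x, 0)]. Degree [k] of the cone involves [j] in degrees [k] and
   [k + 1], hence the bound -1. *)
- exists (fun i : int => pair_mor (p (i + 1) \comp prr_) 0
    : Hom (cone J (i + 1)) (cone J i)) => i i1.
  rewrite !cone_diffE.
  have [|jp1 pj1] := pP (i + 1); first by lia.
  have [|jp2 pj2] := pP (i + 1 + 1); first by lia.
  have dp : d (i + 1) \comp p (i + 1) = p (i + 1 + 1) \comp cdiff X (i + 1).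
    apply: (mj (i + 1 + 1)).
    by rewrite !compA -dP -compA jp1 jp2 compm1 comp1m.
  apply: eq_to_dsum; rewrite compm1 compDr.
    rewrite !(compA prl_) !prl_pair compNm -!compA prl_pair prr_pair.
    rewrite compDr !compA pj2 comp1m [cdiff TT _]/= dp.
    by rewrite addrCA addNr addr0.
  rewrite !(compA prr_) !prr_pair comp0m addr0 compDl -!compA.
  by rewrite prl_pair prr_pair compm0 addr0 compA jp1 comp1m.
- by move=> i i0; have [_ _] := jP i; exact.
apply/acyclicP => //; split=> i.
  case: (ltP i 0) => i0; last first.
    exists (T i), (idm (T i)); suff -> : cdiff TT i = 0 by exact: kernel_zero_morphism.
    by apply: (mj (i + 1)); rewrite compm0 -dP dj0.
  have [K [a ka]] := kerX i; have [jp pj] := pP i i0.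
  have kE W (w : Hom W (T i)) : cdiff TT i \comp w = 0 <->
      cdiff X i \comp (j i \comp w) = 0.
    rewrite compA dP -compA; split=> [->|]; first by rewrite compm0.
    by rewrite -(compm0 _ (j (i + 1))) => /mj.
  exists K, (p i \comp a); apply: kernelI.
  - by apply/kE; rewrite (compA (j i)) jp comp1m (proj1 ka).
  - move=> W u v; rewrite -!compA => /(congr1 (comp (j i))).
    by rewrite !(compA (j i)) jp !comp1m => /(kernel_monic ka).
  move=> W w /kE /(kernel_lift ka)[u au]; exists u.
  by rewrite -compA au compA pj comp1m.
(* If [i + 1] is at most 0, then [i] is negative and a preimage [v] in [X i] lifts to [T i] through
   [p i]; this includes exactness at the kernel in degree 0. *)
move=> W w dw; case: (ltP 0 (i + 1)) => i0.
  exists W, (idm W), 0; split; first exact: admissible_epi_id.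
  rewrite compm0 (hom_to_zero w) ?comp0m //.
  by have [_ _] := jP (i + 1); exact.
have [|W' [q [v [eq wq]]]] := lexX i W (j (i + 1) \comp w).
  by rewrite compA dP -compA dw compm0.
exists W', q, (p i \comp v); split=> //; apply: (mj (i + 1)).
have [|jp pj] := pP i; first by lia.
by rewrite compA wq compA -dP -compA (compA (j i)) jp comp1m.
Qed.

(* The complexes overlap only in the degrees [i + 1] and [i + 1 + 1], where the
   differential of [Y] is a kernel; the null homotopy is the lift of [f]. *)
Lemma hclass_orthogonal (i : int) X Y (f : chain_map X Y) : acyclic Y ->
  zero_above (i + 1 + 1) X -> zero_below (i + 1) Y -> hclass f = 0.
Proof.
move=> aY X0 Y0; have lexY := acyclic_locally_exact aY.
(* [Y] vanishes in degree [i], so its cycles in degree [i + 1] are locally zero. *)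
have md : monic (cdiff Y (i + 1)).
  apply: monic0 => W w /lexY[W' [q [v [eq]]]].
  rewrite (hom_to_zero v) ?compm0; last by apply: Y0; lia.
  by rewrite -(comp0m _ q) => /(adm_epi_epic eq).
have [|W [q [v [eq fq]]]] := lexY (i + 1) _ (f (i + 1 + 1)).
  by rewrite cmapP (hom_to_zero (cdiff X _)) ?compm0 //; apply: X0; lia.
(* The local lift [v] kills the kernel of [q], because the differential is monic, and so descends
   along [q]. *)
have [s fs] : exists s, f (i + 1 + 1) = cdiff Y (i + 1) \comp s.
  have [K [k kq]] := eq.
  have [|s sq] := cokernel_desc (w := v) (ses_cokernel kq).
    apply: md; rewrite compA -fq -compA (proj1 (ses_kernel kq)).
    by rewrite !compm0.
  by exists s; apply: (adm_epi_epic eq); rewrite fq -compA sq.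
have fs' : f (i + 1) = s \comp cdiff X (i + 1).
  by apply: md; rewrite cmapP fs compA.
(* The homotopy is [s] at the single index [i + 1] and 0 elsewhere. *)
have /dependent_choice[h hP] (k : int) : exists h : Hom (X (k + 1)) (Y k),
    (k = i + 1 -> f (k + 1) = cdiff Y k \comp h /\ f k = h \comp cdiff X k) /\
    (k <> i + 1 -> h = 0).
  by have [->|ki] := pselect (k = i + 1); [exists s | exists 0].
rewrite -hclass0; apply/hclass_homotopicP; exists h => k; rewrite [_ 0]/= add0r.
have [ki|ki] := pselect (k = i + 1).
  by rewrite ((hP k).1 ki).1 (hP (k + 1)).2 ?comp0m ?addr0 //; lia.
rewrite (hP k).2 // compm0 add0r.
have [ki'|ki'] := pselect (k + 1 = i + 1); first by rewrite ((hP (k + 1)).1 ki').2.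
rewrite (hP (k + 1)).2 // comp0m.
case: (ltP (k + 1) (i + 1)) => [/Y0/hom_to_zero|ki2]; first exact.
by apply: hom_from_zero; apply: X0; lia.
Qed.

End AcyclicComplexes.

(** * The t-structure *)

Section TStructureOnAcyclic.
Variables (E : exact_category) (idE : idempotent_complete E).
Implicit Types X Y : KC E.

(** This trades the existence of a bounded representative for a condition on [X] itself; the
    convexity of [P] is the one required by [contractible_on_zero_on]. *)
Lemma Ac_such_zero_onP (P : int -> Prop) X :
  (forall i : int, P i -> P (i + 1 + 1) -> P (i + 1)) ->
  Ac_such (zero_on P) X <-> acyclic X /\ contractible_on P X.
Proof.
move=> Pconv; split=> [[aX [Y [aY Y0 XY]]]|[aX cX]]; split=> //.
  exact: contractible_on_iso XY (zero_contractible_on Y0).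
have [Y [XY Y0 _]] := contractible_on_zero_on idE Pconv cX.
by exists Y; split=> //; exact: acyclic_isomorphic (isomorphic_sym XY) aX.
Qed.

Lemma Ac_le0P X :
  Ac_le0 E X <-> acyclic X /\ contractible_on (fun i => 0 < i) X.
Proof. by apply: Ac_such_zero_onP => i; lia. Qed.

Lemma Ac_ge0P X :
  Ac_ge0 E X <-> acyclic X /\ contractible_on (fun i => i < -2) X.
Proof. by apply: Ac_such_zero_onP => i; lia. Qed.

(* All four subcategories of the theorem at once: [a] and [b] say whether the
   complexes are bounded above and below. *)
Definition Ac_bounded (a b : bool) : set (KC E) :=
  Ac_such (fun X => (a -> bounded_above X) /\ (b -> bounded_below X)).

Lemma Ac_boundedP (a b : bool) X : Ac_bounded a b X <->
  [/\ acyclic X, a -> exists n : int, contractible_on (fun i => n < i) X &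
      b -> exists n : int, contractible_on (fun i => i < n) X].
Proof.
split=> [[aX [Y [aY [Ya Yb] XY]]]|[aX Xa Xb]].
  split=> // [/Ya|/Yb] [n Y0]; exists n.
    exact: contractible_on_iso XY (zero_contractible_on Y0).
  exact: contractible_on_iso XY (zero_contractible_on Y0).
have [Y [XY Ya]] : exists Y, isomorphic X Y /\ (a -> bounded_above Y).
  case: a Xa => [/(_ isT)[n cX]|_]; last first.
    by exists X; split=> //; exact: isomorphic_refl.
  have [|Y [XY Y0 _]] := contractible_on_zero_on idE _ cX.
    by move=> i; lia.
  by exists Y; split=> // _; exists n.
have YX := isomorphic_sym XY.
have [Z [YZ Za Zb]] : exists Z : KC E, [/\ isomorphic Y Z,
    a -> bounded_above Z & b -> bounded_below Z].
  case: b Xb => [/(_ isT)[n cX]|_]; last first.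
    by exists Y; split=> //; exact: isomorphic_refl.
  (* Truncating below preserves the zeros already obtained above, by the last clause [ZY]. *)
  have [|Z [YZ Z0 ZY]] := contractible_on_zero_on idE _ (contractible_on_iso YX cX).
    by move=> i; lia.
  exists Z; split=> // [/Ya[m Y0]|_]; last by exists n.
  by exists m; exact: ZY Y0.
have XZ := isomorphic_trans XY YZ.
split=> //; exists Z; split=> //.
exact: acyclic_isomorphic (isomorphic_sym XZ) aX.
Qed.

Lemma triangulated_subcategory_Ac_bounded (a b : bool) :
  triangulated_subcategory (Ac_bounded a b).
Proof.
have Diso X Y : Ac_bounded a b X -> isomorphic X Y -> Ac_bounded a b Y.
  move=> /Ac_boundedP[aX Xa Xb] /isomorphic_sym YX; apply/Ac_boundedP; split.
  - exact: acyclic_isomorphic YX aX.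
  - by move=> /Xa[n cX]; exists n; exact: contractible_on_iso YX cX.
  by move=> /Xb[n cX]; exists n; exact: contractible_on_iso YX cX.
split=> [|||X Y Z f g h].
- have z P : zero_on P (czero E) by move=> i _; exact: zobP.
  apply/Ac_boundedP; split; first exact: acyclic_czero.
    by move=> _; exists 0; exact: zero_contractible_on.
  by move=> _; exists 0; exact: zero_contractible_on.
- exact: Diso.
- move=> X; split=> /Ac_boundedP[aX Xa Xb]; apply/Ac_boundedP; split.
  + by apply/acyclic_cshift.
  + move=> /Xa[n cX]; exists (n + 1); apply: contractible_on_of_cshift cX => i.
    by lia.
  + move=> /Xb[n cX]; exists (n + 1); apply: contractible_on_of_cshift cX => i.
    by lia.
  + by apply/acyclic_cshift.
  + move=> /Xa[n cX]; exists (n - 1); apply: contractible_on_cshift cX => i.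
    by lia.
  + move=> /Xb[n cX]; exists (n - 1); apply: contractible_on_cshift cX => i.
    by lia.
move=> [X' [Y' [f' [u [v [w [ui vi wi _]]]]]]] DX DY.
have /Ac_boundedP[aX Xa Xb] : Ac_bounded a b (X' : KC E).
  by apply: Diso DX _; exists u.
have /Ac_boundedP[aY Ya Yb] : Ac_bounded a b (Y' : KC E).
  by apply: Diso DY _; exists v.
apply: (Diso (cone f')); last by apply: isomorphic_sym; exists w.
apply/Ac_boundedP; split; first exact: acyclic_cone.
  move=> aT; have [n cX] := Xa aT; have [m cY] := Ya aT.
  exists (Order.max n m); apply: contractible_on_cone cX cY => i nmi.
  by split; lia.
move=> bT; have [n cX] := Xb bT; have [m cY] := Yb bT.
(* The shift by 1 accounts for the degree [i + 1] that enters degree [i] of the cone. *)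
exists (Order.min n m - 1); apply: contractible_on_cone cX cY => i nmi.
by split; lia.
Qed.

Lemma tstructure_Ac_bounded (a b : bool) :
  tstructure (Ac_bounded a b)
    (Ac_bounded a b `&` Ac_le0 E) (Ac_bounded a b `&` Ac_ge0 E).
Proof.
have tri := triangulated_subcategory_Ac_bounded a b; split=> //.
- move=> X Y [DX [aX [Z [aZ Z0 XZ]]]] XY; have DY := tsub_iso tri DX XY.
  split=> //; split; first by have /Ac_boundedP[] := DY.
  by exists Z; split=> //; exact: isomorphic_trans (isomorphic_sym XY) XZ.
- move=> X Y [DX [aX [Z [aZ Z0 XZ]]]] XY; have DY := tsub_iso tri DX XY.
  split=> //; split; first by have /Ac_boundedP[] := DY.
  by exists Z; split=> //; exact: isomorphic_trans (isomorphic_sym XY) XZ.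
- move=> X [DX /Ac_le0P[aX cX]]; split; first exact/(tsub_shift tri).
  apply/Ac_le0P; split; first exact/acyclic_cshift.
  by apply: contractible_on_cshift cX => i; lia.
- move=> X DX [_ /Ac_ge0P[aX cX]]; split=> //; apply/Ac_ge0P; split.
    exact/acyclic_cshift.
  by apply: contractible_on_of_cshift cX => i; lia.
- move=> X Y f [_ [_ [X' [aX' X0 XX']]]] DY [_ /Ac_ge0P[aY cY]].
  have cY' : contractible_on (fun i => i < -1) Y.
    by apply: contractible_on_of_cshift cY => i; lia.
  have [|Y' [YY' Y0 _]] := contractible_on_zero_on idE _ cY'.
    by move=> i; lia.
  have aY' : acyclic Y'.
    by apply: acyclic_isomorphic (isomorphic_sym YY') _ => //; exact/acyclic_cshift.
  have [x [x' [x'x _]]] := XX'; have [y [y' [y'y _]]] := YY'.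
  have [g gE] := hclassP (y \comp f \comp x').
  have g0 : y \comp f \comp x' = 0.
    (* With this index the bounds [i + 1 + 1] and [i + 1] become 0 for [X'] and -1 for [Y']. *)
    by rewrite gE; exact: (@hclass_orthogonal _ (-2)).
  rewrite -[f]comp1m -y'y -[_ \comp f]compm1 -x'x -!compA.
  by rewrite (compA f) (compA y) (compA y) g0 comp0m compm0.
(* The truncation is applied to the bounded representative [X'], so that [T] has the same bounds. *)
move=> X DX; have [aX [X' [aX' [X'a X'b] XX']]] := DX.
have DX' := tsub_iso tri DX XX'.
have [T [j [aT T0 zT cT]]] := exists_truncation idE aX'.
have DT : Ac_bounded a b T.
  split=> //; exists T; split=> //; last exact: isomorphic_refl.
  by split=> [/X'a|/X'b] [n X0]; exists n; exact: zT.
have DC := tsub_cone tri (distinguished_cone j) DT DX'.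
have [x [x' [x'x xx']]] := XX'.
have dist := distinguished_iso_mid xx' x'x (distinguished_cone j).
exists (T : KC E), (cone j : KC E); do 3!eexists; split; first exact: dist.
- split=> //; split=> //; exists T; split=> //; exact: isomorphic_refl.
- exact: DC.
split; first exact/(tsub_shift tri).
apply/Ac_ge0P; split; first by apply/acyclic_cshift => //; have /Ac_boundedP[] := DC.
by apply: contractible_on_cshift cT => i; lia.
Qed.

(** * Bounded parts of the t-structures and their hearts *)

Lemma tsub_iter_shift (T : triangulated_data) (D : set T) n (X : T) :
  triangulated_subcategory D -> D (iter n shift X) <-> D X.
Proof. by move=> tri; elim: n => //= n IHn; rewrite (tsub_shift tri). Qed.

Lemma contractible_on_iter_shift (P : int -> Prop) n X :
  contractible_on P (iter n shift X) <->
  contractible_on (fun i => P (i - n%:Z)) X.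
Proof.
elim: n P => [|n IHn] P /=.
  by split; apply: contractible_on_sub => i; rewrite subr0.
have eS (i : int) : i - n.+1%:Z = i - n%:Z - 1 by lia.
split=> [cX|cX].
  have /IHn : contractible_on (fun i => P (i - 1)) (iter n shift X).
    by apply: contractible_on_of_cshift cX => i; rewrite addrK.
  by apply: contractible_on_sub => i; rewrite eS.
apply: (@contractible_on_cshift _ _ (fun i => P (i - 1))) => [i|].
  by rewrite addrK.
by apply/IHn; apply: contractible_on_sub cX => i; rewrite eS.
Qed.

Lemma tst_minus_Ac_bounded (a b : bool) :
  tst_minus (Ac_bounded a b) (Ac_bounded a b `&` Ac_le0 E) = Ac_bounded true b.
Proof.
have tri := triangulated_subcategory_Ac_bounded a b.
apply/seteqP; split=> X.
  move=> [n _ [/Ac_boundedP[aX Xa Xb] [_ /Ac_le0P[_ cX]]]].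
  apply/Ac_boundedP; split=> // _; exists n%:Z.
  have /contractible_on_iter_shift := cX.
  by apply: contractible_on_sub => i /=; lia.
move=> /Ac_boundedP[aX /(_ isT)[n cX] Xb].
have DX : Ac_bounded a b X by apply/Ac_boundedP; split=> // _; exists n.
(* The index has to be a natural number that is at least 1 and at least [n]. *)
exists (maxn 1 `|n|); first exact: leq_maxl.
split=> //; split; first exact/tsub_iter_shift.
apply/Ac_le0P; split.
  by have /Ac_boundedP[] : Ac_bounded a b (iter (maxn 1 `|n|) shift X);
    [exact/tsub_iter_shift|].
apply/contractible_on_iter_shift.
by apply: contractible_on_sub cX => i /=; lia.
Qed.

Lemma tst_plus_Ac_bounded (a b : bool) :
  tst_plus (Ac_bounded a b) (Ac_bounded a b `&` Ac_ge0 E) = Ac_bounded a true.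
Proof.
have tri := triangulated_subcategory_Ac_bounded a b.
apply/seteqP; split=> X.
  move=> [n _ [/Ac_boundedP[aX Xa Xb] [Y [_ /Ac_ge0P[_ cY]] XY]]].
  apply/Ac_boundedP; split=> // _; exists (-2 - n%:Z).
  apply: contractible_on_iso XY _.
  by apply/contractible_on_iter_shift; apply: contractible_on_sub cY => i /=; lia.
move=> /Ac_boundedP[aX Xa /(_ isT)[n cX]].
have DX : Ac_bounded a b X by apply/Ac_boundedP; split=> // _; exists n.
(* [X] is isomorphic to the [k]-fold shift of [Y], so [Y] is contractible below [n + k]; the choice
   ensures that [k] is at least 1 and [n + k] at least -2. *)
pose k := (maxn 1 `|n|).+2.
exists k => //; split=> //; have [Y XY] := exists_iter_unshift k X.
have DY : Ac_bounded a b Y by apply/(tsub_iter_shift k _ tri); exact: tsub_iso XY.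
exists Y => //; split=> //; apply/Ac_ge0P; split; first by have /Ac_boundedP[] := DY.
have := contractible_on_iso (isomorphic_sym XY) cX.
move=> /contractible_on_iter_shift; apply: contractible_on_sub => i /=.
by rewrite /k; lia.
Qed.

Lemma Ac_boundedI (a b a' b' : bool) :
  Ac_bounded a b `&` Ac_bounded a' b' = Ac_bounded (a || a') (b || b').
Proof.
apply/seteqP; split=> X.
  move=> [/Ac_boundedP[aX Xa Xb] /Ac_boundedP[_ Xa' Xb']].
  by apply/Ac_boundedP; split=> // /orP[]; auto.
move=> /Ac_boundedP[aX Xa Xb]; split; apply/Ac_boundedP; split=> // H;
  by [apply: Xa; rewrite H ?orbT | apply: Xb; rewrite H ?orbT].
Qed.

(** An object of the heart is contractible above 0 and below -2, hence already bounded on both sides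
    up to isomorphism. *)
Lemma heart_Ac_bounded (a b : bool) :
  heart (Ac_bounded a b `&` Ac_le0 E) (Ac_bounded a b `&` Ac_ge0 E) =
  heart (Ac_le0 E) (Ac_ge0 E).
Proof.
apply/seteqP; split=> X [] => [[_ XL] [_ XG]|XL XG]; first by split.
suff DX : Ac_bounded a b X by split.
have /Ac_le0P[aX cX] := XL; have /Ac_ge0P[_ cX'] := XG.
by apply/Ac_boundedP; split=> // _; [exists 0 | exists (-2)].
Qed.

(** * Translation to the four categories of the theorem *)

Lemma eq_Ac_such (P Q : cochain_complex E -> Prop) :
  (forall X, P X <-> Q X) -> Ac_such P = Ac_such Q.
Proof.
by move=> PQ; apply/seteqP; split=> X [aX [Y [aY /PQ YP XY]]];
  split=> //; exists Y.
Qed.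

Lemma AcE : Ac E = Ac_bounded false false.
Proof.
apply/seteqP; split=> [X aX|X []//].
by split=> //; exists X; split=> //; exact: isomorphic_refl.
Qed.

Lemma Ac_minusE : Ac_minus E = Ac_bounded true false.
Proof. by apply: eq_Ac_such => X; split=> [|[/(_ isT)]]. Qed.

Lemma Ac_plusE : Ac_plus E = Ac_bounded false true.
Proof. by apply: eq_Ac_such => X; split=> [|[_ /(_ isT)]]. Qed.

Lemma Ac_bE : Ac_b E = Ac_bounded true true.
Proof. by apply: eq_Ac_such => X; split=> [[]|[/(_ isT) ? /(_ isT)]]. Qed.

Lemma Ac_le0E : Ac_le0 E = Ac_bounded false false `&` Ac_le0 E.
Proof. by rewrite -AcE; apply/esym/setIidr => X []. Qed.

Lemma Ac_ge0E : Ac_ge0 E = Ac_bounded false false `&` Ac_ge0 E.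
Proof. by rewrite -AcE; apply/esym/setIidr => X []. Qed.

End TStructureOnAcyclic.

Theorem mainTheorem7 (E : exact_category) (idemE : idempotent_complete E) :
  tstructure (Ac E) (Ac_le0 E) (Ac_ge0 E) /\
  [/\ tst_minus (Ac E) (Ac_le0 E) = Ac_minus E,
      tst_plus (Ac E) (Ac_ge0 E) = Ac_plus E &
      tst_b (Ac E) (Ac_le0 E) (Ac_ge0 E) = Ac_b E] /\
  [/\ tstructure (Ac_minus E) (Ac_minus E `&` Ac_le0 E) (Ac_minus E `&` Ac_ge0 E),
      tstructure (Ac_plus E) (Ac_plus E `&` Ac_le0 E) (Ac_plus E `&` Ac_ge0 E),
      tstructure (Ac_b E) (Ac_b E `&` Ac_le0 E) (Ac_b E `&` Ac_ge0 E) &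
      tst_bounded (Ac_b E) (Ac_b E `&` Ac_le0 E) (Ac_b E `&` Ac_ge0 E)] /\
  [/\ heart (Ac_minus E `&` Ac_le0 E) (Ac_minus E `&` Ac_ge0 E) =
        heart (Ac_le0 E) (Ac_ge0 E),
      heart (Ac_plus E `&` Ac_le0 E) (Ac_plus E `&` Ac_ge0 E) =
        heart (Ac_le0 E) (Ac_ge0 E) &
      heart (Ac_b E `&` Ac_le0 E) (Ac_b E `&` Ac_ge0 E) =
        heart (Ac_le0 E) (Ac_ge0 E)].
Proof.
have tstr := tstructure_Ac_bounded idemE.
have minusE := tst_minus_Ac_bounded idemE.
have plusE := tst_plus_Ac_bounded idemE.
have heartE := heart_Ac_bounded idemE.
have := (minusE false false, plusE false false, tstr false false).
rewrite Ac_minusE Ac_plusE Ac_bE -Ac_le0E -Ac_ge0E -AcE => -[[mE pE] t].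
split=> //; split; first split=> //.
  by rewrite /tst_b mE pE Ac_boundedI.
split; split=> //.
(* Relative to the bounded complexes, the minus part and the plus part are each the whole
   category. *)
by rewrite /tst_bounded /tst_b minusE plusE setIid.
Qed.
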